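(* Every graph that does not contain the $4\times 4$ grid as a minor has treewidth at most $160$.
   Context: Graphs are finite and simple. The $4\times4$ grid is the Cartesian product of two paths on $4$ vertices. *)

(* Defs.v *)
From mathcomp Require Import all_boot.
From mathcomp Require boolp.

Set Implicit Arguments.
Unset Strict Implicit.
Unset Printing Implicit Defensive.

(** ** Finite simple graphs *)

Record sgraph := SGraph {
  vertex :> finType;
  edge : rel vertex;
  edge_sym : symmetric edge;
  edge_irr : irreflexive edge }.

(* [S] is nonempty and induces a connected subgraph of [G]. *)
Definition connected_set (G : sgraph) (S : {set G}) : Prop :=
  S != set0 /\
  {in S &, forall x y,
     connect [rel u v : G | [&& u \in S, v \in S & edge u v]] x y}.

(* [ucycle edge c] allows backtracking along one edge, so that [c] is a cycle
   of the graph only if it has at least three vertices. *)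
Definition acyclic (G : sgraph) : Prop :=
  forall c : seq G, ucycle (@edge G) c -> size c <= 2.

Definition is_tree (G : sgraph) : Prop :=
  connected_set [set: G] /\ acyclic G.

(** ** Grids *)

Definition path_edge (n : nat) : rel 'I_n :=
  [rel i j : 'I_n | (i.+1 == j :> nat) || (j.+1 == i :> nat)].

Lemma path_edge_sym n : symmetric (@path_edge n).
Proof. by move=> i j; apply: orbC. Qed.

Lemma path_edge_irr n : irreflexive (@path_edge n).
Proof. by move=> i; rewrite /path_edge /= orbb gtn_eqF. Qed.

Definition path_graph (n : nat) : sgraph :=
  SGraph (@path_edge_sym n) (@path_edge_irr n).

Section CartesianProduct.
Variables G H : sgraph.

Definition cartesian_edge : rel (G * H) :=
  [rel u v : G * H | (u.1 == v.1) && edge u.2 v.2 || (u.2 == v.2) && edge u.1 v.1].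

Lemma cartesian_edge_sym : symmetric cartesian_edge.
Proof.
move=> [a b] [c d]; rewrite /cartesian_edge /=.
by rewrite (eq_sym a) (eq_sym b) (edge_sym a) (edge_sym b).
Qed.

Lemma cartesian_edge_irr : irreflexive cartesian_edge.
Proof. by move=> [a b]; rewrite /cartesian_edge /= !edge_irr !andbF. Qed.

Definition cartesian_product : sgraph :=
  SGraph cartesian_edge_sym cartesian_edge_irr.

End CartesianProduct.

Definition grid (m n : nat) : sgraph :=
  cartesian_product (path_graph m) (path_graph n).

(** ** Minors *)

(* [B x] is the branch set of [x]: contracting each branch set to a vertex,
   and deleting the other vertices and the superfluous edges, turns [G]
   into [H]. *)
Definition minor_model (H G : sgraph) (B : H -> {set G}) : Prop :=
  [/\ forall x : H, connected_set (B x),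
      forall x y : H, x != y -> [disjoint B x & B y]
    & forall x y : H, edge x y ->
        exists u v : G, [/\ u \in B x, v \in B y & edge u v]].

Definition is_minor (H G : sgraph) : Prop :=
  exists B : H -> {set G}, minor_model B.

(** ** Treewidth *)

Definition tree_decomposition (G T : sgraph) (B : T -> {set G}) : Prop :=
  [/\ is_tree T,
      forall v : G, exists t : T, v \in B t,
      forall u v : G, edge u v -> exists t : T, (u \in B t) && (v \in B t)
    & forall v : G, connected_set [set t | v \in B t]].

(* The predecessor is truncated: the graph without vertices gets width [0]
   instead of [-1]. *)
Definition width (G T : sgraph) (B : T -> {set G}) : nat :=
  (\max_(t : T) #|B t|).-1.

Definition has_width (G : sgraph) (k : nat) : Prop :=
  exists (T : sgraph) (B : T -> {set G}), tree_decomposition B /\ width B = k.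

Lemma path1_tree : is_tree (path_graph 1).
Proof.
split; last by move=> c /andP[_ /card_uniqP <-]; rewrite (leq_trans (max_card _)) ?card_ord.
by split; [apply/set0Pn; exists ord0 | move=> x y _ _; rewrite (ord1 x) (ord1 y)].
Qed.

Lemma has_width_ex (G : sgraph) : exists k, boolp.asbool (has_width G k).
Proof.
pose B (t : path_graph 1) := [set: G].
exists (width B); apply/boolp.asboolP; exists (path_graph 1), B; split=> //.
split; first exact: path1_tree.
- by move=> v; exists ord0; rewrite inE.
- by move=> u v _; exists ord0; rewrite !inE.
- move=> v; suff -> : [set t | v \in B t] = [set: path_graph 1].
    by case: path1_tree.
  by apply/setP=> t; rewrite !inE.
Qed.

(* The least width of a tree decomposition of [G]. *)
Definition treewidth (G : sgraph) : nat := ex_minn (has_width_ex G).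

(* Main.v *)
Require Import Defs.
From mathcomp Require Import all_boot zify.
From mathcomp Require boolp.

Set Implicit Arguments.
Unset Strict Implicit.
Unset Printing Implicit Defensive.

(** Large treewidth forces a bramble of large order; a bramble of order at
    least 162 yields two disjoint cycles joined by 51 disjoint paths; and two
    cycles joined in this way contain the grid.

    Brambles.  If the treewidth exceeds 160, then by the duality of Seymour and
    Thomas there is a bramble of order at least 162 = 3 * 51 + 9
    ([treewidth_bramble]).  The proof of Bellenbaum and Diestel is followed, for
    rooted tree decompositions that are built inductively ([bramble_duality]);
    its main ingredient is Menger's theorem ([menger]).

    Cycles.  For a set X of vertices let h(X) be the order of the subfamily of
    the elements that meet X.  This function is subadditive, and it is at most 1
    on single vertices, so along a path it takes all intermediate values.  If
    h(X) and h(Y) are at least k, then a set of fewer than k vertices misses an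
    element meeting X and an element meeting Y; these two touch, so by Menger
    there are k disjoint paths from X to Y.  A shortest path meeting all the
    elements closes up to a cycle with the same property ([bramble_cycle]).
    Therefore one needs only a cycle C with N <= h(C) and h(C) + N <= order:
    the elements that miss C provide a second one.  To find C, take a cycle
    meeting all the elements and in it an arc M with h(M) = N, followed on both
    sides by arcs X and Y of order 6 with respect to the elements that miss M.
    Six disjoint paths join Y to X off M.  Four of them, together with pieces of
    X and Y, form two disjoint cycles.  If both have h >= N, these are the
    cycles wanted.  Otherwise one of them has h < N, and a path contained in it
    closes X, M and Y up to a cycle C with h(C) at most N + (N - 1) + 5 + 5.
    This works as soon as the order is 3 * N + 9 ([disjoint_cycles]).

    Grid.  The 4 x 4 grid consists of a cycle of length 12 around a cycle of
    length 4, each inner vertex being joined to the two neighbours of one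
    corner.  So it suffices to have four blocks of three joining paths such that
    the blocks occur in the same cyclic order, up to reversal, on both cycles:
    the middle path of each block marks a corner on the first cycle, and the
    second cycle is contracted to one vertex for each block, whence the order
    inside a block is irrelevant there ([grid_model]).  Such blocks are found by
    an argument in the manner of Erdos and Szekeres in every set of points of
    the plane that consists of 10 points and, above and to the right of them,
    of 17 further points ([four_blocks]); and if the two cycles are cut open at
    suitable places, 51 = 25 + 25 + 1 paths provide such a configuration
    ([grid_of_cycles]). *)

(** * Menger's theorem *)

Section Menger.
Variable V : finType.
Implicit Types (e : rel V) (A B S : {set V}) (x y z : V) (p q : seq V).

Lemma path_suffix e x p q z r :
  x :: p = q ++ z :: r -> path e x p -> path e z r /\ last z r = last x p.
Proof.
case: q => [|w q] /= [-> ->] //.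
by rewrite cat_path /= last_cat /= => /and3P[].
Qed.

Lemma first_hit x p S y : y \in x :: p -> y \in S ->
  exists q r, [/\ p = q ++ r, last x q \in S & {in belast x q, forall z, z \notin S}].
Proof.
elim: p x => [|w p IH] x yp yS.
  by exists [::], [::]; split=> //=; move: yp; rewrite inE => /eqP <-.
have [xS|xS] := boolP (x \in S); first by exists [::], (w :: p).
move: yp; rewrite inE; case: eqP => [yx|_ /= yp]; first by rewrite -yx yS in xS.
have [q [r [-> lS qS]]] := IH w yp yS.
exists (w :: q), r; split=> //= z; rewrite inE => /predU1P[->|/qS] //.
Qed.

Lemma last_hit x p S y : y \in x :: p -> y \in S ->
  exists q z r, [/\ x :: p = q ++ z :: r, z \in S & {in r, forall w, w \notin S}].
Proof.
elim: p x y => [|w p IH] x y yp yS.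
  by exists [::], x, [::]; split=> //=; move: yp; rewrite inE => /eqP <-.
have [/hasP[u up uS]|/hasPn h] := boolP (has (mem S) (w :: p)).
  have [q [z [r [-> zS rS]]]] := IH w u up uS.
  by exists (x :: q), z, r.
exists [::], x, (w :: p); split=> //.
by move: yp; rewrite inE => /predU1P[<- //|/h]; rewrite inE yS.
Qed.

Definition separates e A B S := forall x p,
  x \in A -> path e x p -> last x p \in B -> exists2 y, y \in x :: p & y \in S.

Definition linkage e A B k (a : 'I_k -> V) (p : 'I_k -> seq V) :=
  [/\ forall i, a i \in A, forall i, last (a i) (p i) \in B,
      forall i, path e (a i) (p i), forall i, uniq (a i :: p i)
    & forall i j z, z \in a i :: p i -> z \in a j :: p j -> i = j].

Definition linked e A B k := exists (a : 'I_k -> V) (p : 'I_k -> seq V), linkage e A B a p.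

(** Shortening a walk to a path keeps its ends and introduces no vertex, so
    uniqueness inside each walk need not be checked. *)
Lemma linked_walks e A B k (a : 'I_k -> V) (p : 'I_k -> seq V) :
    (forall i, a i \in A) -> (forall i, last (a i) (p i) \in B) ->
    (forall i, path e (a i) (p i)) ->
    (forall i j z, z \in a i :: p i -> z \in a j :: p j -> i = j) ->
  linked e A B k.
Proof.
move=> aA pB ep disj; exists a, (fun i => shorten (a i) (p i)).
have sub i z : z \in a i :: shorten (a i) (p i) -> z \in a i :: p i.
  case/shortenP: (ep i) => p' _ _ sp'; rewrite !inE => /orP[->//|/sp' ->].
  by rewrite orbT.
split=> // [i|i|i|i j z /sub zi /sub zj]; last exact: disj zi zj.
- by case/shortenP: (ep i) (pB i).
- by case/shortenP: (ep i).
- by case/shortenP: (ep i).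
Qed.

Lemma linked_sub e e' A B k : subrel e e' -> linked e A B k -> linked e' A B k.
Proof.
move=> ee' [a [p [aA pB ep up disj]]]; exists a, p; split=> // i.
exact: sub_path (ep i).
Qed.

(** The ends of [k] disjoint paths are [k] distinct vertices; when the target
    set has only [k] elements, they exhaust it.  In particular no path can pass
    through the target before its end ([linkage_end_only]). *)
Lemma linkage_ends e A B k (a : 'I_k -> V) (p : 'I_k -> seq V) :
  linkage e A B a p -> #|B| = k -> forall y, y \in B -> exists i, last (a i) (p i) = y.
Proof.
case=> aA pB ep up disj cB.
have inj : injective (fun i => last (a i) (p i)).
  by move=> i j /= eqij; apply: (disj _ _ (last (a i) (p i))); rewrite ?mem_last // eqij mem_last.
have <- : [set last (a i) (p i) | i in 'I_k] = B.
  apply/eqP; rewrite eqEcard card_imset // card_ord cB leqnn andbT.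
  by apply/subsetP=> _ /imsetP[i _ ->].
by move=> y /imsetP[i _ ->]; exists i.
Qed.

Lemma linkage_starts e A B k (a : 'I_k -> V) (p : 'I_k -> seq V) :
  linkage e A B a p -> #|A| = k -> forall y, y \in A -> exists i, a i = y.
Proof.
case=> aA pB ep up disj cA.
have inj : injective a.
  by move=> i j eqij; apply: (disj _ _ (a i)); rewrite ?mem_head // eqij mem_head.
have <- : [set a i | i in 'I_k] = A.
  apply/eqP; rewrite eqEcard card_imset // card_ord cA leqnn andbT.
  by apply/subsetP=> _ /imsetP[i _ ->].
by move=> y /imsetP[i _ ->]; exists i.
Qed.

Lemma linkage_end_only e A B k (a : 'I_k -> V) (p : 'I_k -> seq V) i z :
  linkage e A B a p -> #|B| = k -> z \in a i :: p i -> z \in B -> z = last (a i) (p i).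
Proof.
move=> lk cB zi zB; have [j zj] := linkage_ends lk cB zB.
case: lk => _ _ _ _ disj; rewrite -zj (disj i j z zi) //.
by rewrite -zj mem_last.
Qed.

Lemma linkage_start_only e A B k (a : 'I_k -> V) (p : 'I_k -> seq V) i z :
  linkage e A B a p -> #|A| = k -> z \in a i :: p i -> z \in A -> z = a i.
Proof.
move=> lk cA zi zA; have [j zj] := linkage_starts lk cA zA.
case: lk => _ _ _ _ disj; rewrite -zj (disj i j z zi) //.
by rewrite -zj mem_head.
Qed.

Definition del_edge e x y : rel V := [rel u v | e u v && ((u, v) != (x, y))].

Lemma del_edge_src e x y u p :
  path e u p -> {in belast u p, forall w, w != x} -> path (del_edge e x y) u p.
Proof.
elim: p u => //= w p IH u /andP[euw ep] h.
rewrite IH // ?andbT; last by move=> z zp; apply: h; rewrite inE zp orbT.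
by rewrite /del_edge /= euw xpair_eqE (negPf (h u _)) // mem_head.
Qed.

Lemma del_edge_tgt e x y u p :
  path e u p -> {in p, forall w, w != y} -> path (del_edge e x y) u p.
Proof.
elim: p u => //= w p IH u /andP[euw ep] h.
rewrite IH // ?andbT; last by move=> z zp; apply: h; rewrite inE zp orbT.
by rewrite /del_edge /= euw xpair_eqE (negPf (h w _)) ?andbF // mem_head.
Qed.

(** If a path of the first system meets a path of the second one in [z], then
    following the first up to [z] and the second from [z] on leads from [A] to
    [B], hence through [S].  As [S] is met by the first system only in ends and
    by the second only in starts, [z] is both. *)
Lemma linkage_cross e A B S (X Y : {set V}) k (a b : 'I_k -> V) (p q : 'I_k -> seq V) i j z :
    separates e A B S -> S \subset X -> S \subset Y -> #|X| = k -> #|Y| = k ->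
    linkage e A X a p -> linkage e Y B b q ->
    z \in a i :: p i -> z \in b j :: q j ->
  [/\ z \in S, z = last (a i) (p i) & z = b j].
Proof.
move=> sep /subsetP SX /subsetP SY cX cY lk1 lk2 zi zj.
have [aA _ ep up _] := lk1; have [_ qB eq uq _] := lk2.
have [p1 [p2 [epi lp1]]] : exists p1 p2, p i = p1 ++ p2 /\ last (a i) p1 = z.
  by case/splitPl: zi => p1 p2 lp; exists p1, p2.
have [q1 [q2 [eqj lq1]]] : exists q1 q2, q j = q1 ++ q2 /\ last (b j) q1 = z.
  by case/splitPl: zj => q1 q2 lq; exists q1, q2.
have /andP[ep1 ep2] : path e (a i) p1 && path e z p2.
  by have := ep i; rewrite epi cat_path lp1.
have /andP[eq1 eq2] : path e (b j) q1 && path e z q2.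
  by have := eq j; rewrite eqj cat_path lq1.
have lB : last (a i) (p1 ++ q2) \in B.
  by rewrite last_cat lp1; have := qB j; rewrite eqj last_cat lq1.
have [|w] := sep (a i) (p1 ++ q2) (aA i) _ lB; first by rewrite cat_path ep1 lp1.
rewrite -cat_cons mem_cat => /orP[] wp wS.
  have wl : w = last (a i) (p i).
    apply: linkage_end_only lk1 cX _ (SX _ wS).
    by rewrite epi -cat_cons mem_cat wp.
  have wz : w = z.
    move: (up i) wl; rewrite epi -cat_cons cat_uniq => /and3P[_ hn _].
    rewrite last_cat lp1; case: p2 hn {epi ep2} => [|c p2] // hn /= wl.
    case/negP: hn; apply/hasP; exists w => //; rewrite wl; exact: mem_last.
  split; [by rewrite -wz|by rewrite -wz|].
  by apply: linkage_start_only lk2 cY zj _; rewrite -wz; apply: SY.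
have wb : w = b j.
  apply: linkage_start_only lk2 cY _ (SY _ wS).
  by rewrite eqj inE mem_cat wp !orbT.
by move: (uq j); rewrite eqj /= mem_cat -wb wp orbT.
Qed.

(** Goring's proof, by induction on the number of edges.  If deleting the edge
    from [x] to [y] creates a separator [S] of size less than [k], then [x |: S]
    and [y |: S] separate [A] from [B] in the whole graph and thus have size
    [k].  The induction hypothesis gives [k] paths from [A] to [x |: S] and [k]
    paths from [y |: S] to [B] in the smaller graph; they are joined in [S] and
    along the deleted edge. *)
Theorem menger e A B k :
  (forall S, separates e A B S -> k <= #|S|) -> linked e A B k.
Proof.
have [n] := ubnP #|[set z : V * V | e z.1 z.2]|.
elim: n e A B => // n IH e A B; rewrite ltnS => le_n hk.
case: (pickP (fun z : V * V => e z.1 z.2)) => [[x y] /= exy|e0]; last first.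
  have noedge u p : path e u p -> p = [::].
    by case: p => //= v p; rewrite (e0 (u, v)).
  have leAB : k <= #|A :&: B|.
    apply: hk => u p uA /noedge -> uB; exists u; first exact: mem_head.
    by rewrite inE uA.
  pose a (i : 'I_k) := enum_val (widen_ord leAB i).
  have aAB i : a i \in A :&: B by apply: enum_valP.
  apply: (@linked_walks _ _ _ _ a (fun=> [::])) => //= [i|i|i j z].
  - by have := aAB i; rewrite inE => /andP[].
  - by have := aAB i; rewrite inE => /andP[].
  rewrite !inE => /eqP -> /eqP /enum_val_inj; case=> ij; exact: val_inj.
pose e' := del_edge e x y.
have sub_e : subrel e' e by move=> u v /andP[].
have lt_e : #|[set z : V * V | e' z.1 z.2]| < n.
  apply: leq_trans le_n; apply: proper_card; apply/properP; split.
    by apply/subsetP=> z; rewrite !inE => /sub_e.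
  by exists (x, y); rewrite inE //= /e' /del_edge /= eqxx andbF.
have [[S [sepS ltS]]|noS] :=
    boolp.pselect (exists S, separates e' A B S /\ #|S| < k); last first.
  apply: linked_sub sub_e _; apply: IH => // S sepS.
  by rewrite leqNgt; apply/negP=> ltS; apply: noS; exists S.
have sepx : separates e A B (x |: S).
  move=> u p uA ep pB; have [xp|xp] := boolP (x \in u :: p).
    by exists x => //; rewrite setU11.
  have [|w wp wS] := sepS u p uA _ pB.
    apply: del_edge_src => // w /mem_belast wp; by apply: contraNneq xp => <-.
  by exists w => //; rewrite inE wS orbT.
have sepy : separates e A B (y |: S).
  move=> u p uA ep pB; have [xp|xp] := boolP (y \in u :: p).
    by exists y => //; rewrite setU11.
  have [|w wp wS] := sepS u p uA _ pB.
    apply: del_edge_tgt => // w wp; apply: contraNneq xp => <-.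
    by rewrite inE wp orbT.
  by exists w => //; rewrite inE wS orbT.
have [xS cx] : x \notin S /\ #|x |: S| = k.
  have := hk _ sepx; rewrite cardsU1; case: (x \in S) => /=; lia.
have [yS cy] : y \notin S /\ #|y |: S| = k.
  have := hk _ sepy; rewrite cardsU1; case: (y \in S) => /=; lia.
have [a [p lk1]] : linked e' A (x |: S) k.
  apply: IH => // S' sep'; apply: hk => u p uA ep pB.
  have [w wp wS] := sepx u p uA ep pB.
  have [q [r [pqr lq qS]]] := first_hit wp wS.
  move: ep; rewrite pqr cat_path => /andP[eq _].
  have [|z zq zS] := sep' u q uA _ lq.
    by apply: del_edge_src => // z /qS; rewrite !inE negb_or => /andP[].
  by exists z => //; rewrite -cat_cons mem_cat zq.
have [b [q lk2]] : linked e' (y |: S) B k.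
  apply: IH => // S' sep'; apply: hk => u p' uA ep pB.
  have [w wp wS] := sepy u p' uA ep pB.
  have [q [z [r [pqr zS rS]]]] := last_hit wp wS.
  have [er lr] := path_suffix pqr ep.
  have [||v vr vS] := sep' z r zS; last by exists v; rewrite // pqr mem_cat vr orbT.
    by apply: del_edge_tgt => // v /rS; rewrite !inE negb_or => /andP[].
  by rewrite lr.
have cross i j z := @linkage_cross e' A B S _ _ k a b p q i j z sepS
  (subsetUr _ _) (subsetUr _ _) cx cy lk1 lk2.
(* The path ending in [f i] is continued by the one starting in [t i]. *)
pose f i := last (a i) (p i).
pose t i := if f i == x then y else f i.
have [aA pX ep up disj] := lk1; have [bY qB eq uq disj'] := lk2.
have tY i : t i \in y |: S.
  rewrite /t; case: eqP => [_|/eqP fx]; first by rewrite setU11.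
  by have := pX i; rewrite -/(f i) !inE (negPf fx) => /= ->; rewrite orbT.
have [j jP] : exists j : 'I_k -> 'I_k, forall i, b (j i) = t i.
  by apply: (@fin_all_exists _ (fun=> 'I_k) (fun i v => b v = t i)) => i; apply: linkage_starts lk2 cy _ (tY i).
pose c i := if f i == x then b (j i) :: q (j i) else q (j i).
have fI i i' : f i = f i' -> i = i'.
  by move=> eqf; apply: (disj _ _ (f i)); rewrite /f ?mem_last // -/(f i) eqf mem_last.
have tI i i' : t i = t i' -> i = i'.
  rewrite /t; case: eqP => [fx|_]; case: eqP => [fx'|_]; try exact: fI.
  - by move=> _; apply: fI; rewrite fx fx'.
  - by move=> yf; have := pX i'; rewrite -/(f i') -yf !inE (negPf yS) orbF => /eqP yx; apply: fI; rewrite fx -yf yx.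
  - by move=> yf; have := pX i; rewrite -/(f i) yf !inE (negPf yS) orbF => /eqP yx; apply: fI; rewrite fx' yf yx.
have mem_c i z : z \in a i :: (p i ++ c i) -> z \in a i :: p i \/ z \in b (j i) :: q (j i).
  rewrite -cat_cons mem_cat => /orP[->|zc]; [by left | right].
  by move: zc; rewrite /c; case: ifP => // _ zq; rewrite inE zq orbT.
apply: (@linked_walks _ _ _ _ a (fun i => p i ++ c i)) => // [i|i|i i' z].
- rewrite last_cat -/(f i) /c; case: eqP => [_|/eqP fx]; first exact: qB.
  by have := qB (j i); rewrite jP /t (negPf fx).
- rewrite cat_path (sub_path sub_e (ep i)) /= -/(f i) /c.
  have := sub_path sub_e (eq (j i)); rewrite jP /t.
  by case: eqP => [fx|_] //= ->; rewrite fx exy.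
move=> /mem_c[] zi /mem_c[] zi'.
- exact: disj zi zi'.
- have [zS zl zb] := cross _ _ _ zi zi'.
  apply: fI; move: zb; rewrite jP /t /f -zl; case: eqP => // _ zy.
  by rewrite -zy zS in yS.
- have [zS zl zb] := cross _ _ _ zi' zi.
  apply: fI; move: zb; rewrite jP /t /f -zl; case: eqP => // _ zy.
  by rewrite -zy zS in yS.
- by apply: tI; rewrite -!jP (disj' _ _ _ zi zi').
Qed.

End Menger.


(** * Connected sets *)

Lemma disjointP {T : finType} {A B : {set T}} :
  reflect (forall x, x \in A -> x \notin B) [disjoint A & B].
Proof.
by rewrite disjoint_subset; apply: (iffP subsetP) => h x /h; rewrite inE.
Qed.

Section Connected.
Variable G : sgraph.
Implicit Types (S U W X : {set G}) (x y z : G) (p : seq G).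

Definition inside S : rel G := [rel u v | [&& u \in S, v \in S & edge u v]].

Definition touch U W := [exists u in U, [exists w in W, (u == w) || edge u w]].

Lemma touchP {U W} :
  reflect (exists u w, [/\ u \in U, w \in W & u = w \/ edge u w]) (touch U W).
Proof.
apply: (iffP existsP) => [[u /andP[uU /existsP[w /andP[wW uw]]]]|[u [w [uU wW uw]]]].
  by exists u, w; split=> //; case/orP: uw => [/eqP|]; [left | right].
exists u; rewrite uU; apply/existsP; exists w; rewrite wW /=.
by case: uw => ->; rewrite ?eqxx ?orbT.
Qed.

Lemma touch_sym U W : touch U W = touch W U.
Proof.
by apply/touchP/touchP => [] [u [w [uU wW uw]]]; exists w, u; split=> //;
  rewrite edge_sym; case: uw; [left | right | left | right].
Qed.

Lemma inside_sym S : symmetric (inside S).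
Proof. by move=> x y; rewrite /inside /= edge_sym andbCA. Qed.

Lemma inside_sub S S' : S \subset S' -> subrel (inside S) (inside S').
Proof.
by move=> /subsetP sS x y /and3P[/sS xS /sS yS xy]; rewrite /inside /= xS yS.
Qed.

Lemma walk_inside x p S :
  path (@edge G) x p -> {subset x :: p <= S} -> path (inside S) x p.
Proof.
elim: p x => //= y p IH x /andP[xy ep] sp.
rewrite IH // ?andbT; last by move=> z zp; apply: sp; rewrite inE zp orbT.
by rewrite /inside /= xy !sp // ?inE ?eqxx ?orbT.
Qed.

Lemma inside_walk x p S :
  path (inside S) x p -> path (@edge G) x p /\ {subset p <= S}.
Proof.
elim: p x => //= y p IH x /andP[/and3P[xS yS xy] /IH[-> sp]].
rewrite xy; split=> // z; rewrite inE => /predU1P[->|/sp] //.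
Qed.

Lemma star_connected S x :
  x \in S -> (forall y, y \in S -> connect (inside S) x y) -> connected_set S.
Proof.
move=> xS h; split; first by apply/set0Pn; exists x.
move=> y z /h xy /h; apply: connect_trans.
by rewrite (sym_connect_sym (@inside_sym S)).
Qed.

Lemma inside_connected S x y :
  connected_set S -> x \in S -> y \in S -> connect (inside S) x y.
Proof. by case=> _ cS xS yS; exact: cS. Qed.

Lemma walk_connect x p S z :
  path (@edge G) x p -> {subset x :: p <= S} -> z \in x :: p -> connect (inside S) x z.
Proof. by move=> ep sp; apply: path_connect; exact: walk_inside. Qed.

Lemma walk_connected x p : path (@edge G) x p -> connected_set [set z in x :: p].
Proof.
move=> ep; apply: (@star_connected _ x) => [|y]; first by rewrite inE mem_head.
by rewrite inE => yp; apply: walk_connect ep _ yp => z zp; rewrite inE.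
Qed.

Lemma connected_walk S x y : connected_set S -> x \in S -> y \in S ->
  exists p, [/\ path (@edge G) x p, last x p = y & {subset x :: p <= S}].
Proof.
move=> cS xS yS; have /connectP[p ep ->] := inside_connected cS xS yS.
have [ep' sp] := inside_walk ep; exists p; split=> // z.
by rewrite inE => /predU1P[->|/sp].
Qed.

Lemma inside_connect_sub S S' : S \subset S' ->
  subrel (connect (inside S)) (connect (inside S')).
Proof.
by move=> sS; apply: connect_sub => x y /(inside_sub sS); exact: connect1.
Qed.

Lemma connectedU S W :
  connected_set S -> connected_set W -> touch S W -> connected_set (S :|: W).
Proof.
move=> cS cW /touchP[u [w [uS wW uw]]].
apply: (@star_connected _ u) => [|y]; first by rewrite inE uS.
rewrite inE => /orP[yS|yW].
  by apply: inside_connect_sub (subsetUl _ _) _ _ _; exact: inside_connected.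
apply: (@connect_trans _ _ w).
  case: uw => [->|uw]; first exact: connect0.
  by apply: connect1; rewrite /inside /= !inE uS wW orbT.
by apply: inside_connect_sub (subsetUr _ _) _ _ _; exact: inside_connected.
Qed.

Definition component X x := [set y | connect (inside (~: X)) x y].

Lemma componentP X x : x \notin X ->
  [/\ x \in component X x, connected_set (component X x),
      [disjoint X & component X x]
    & forall u v, u \in component X x -> edge u v -> v \notin X ->
        v \in component X x].
Proof.
move=> xX.
have x0 : x \in component X x by rewrite inE connect0.
have out y : y \in component X x -> y \notin X.
  rewrite inE => /connectP[p /inside_walk[_ sp] ->].
  by have := mem_last x p; rewrite inE => /predU1P[-> //|/sp]; rewrite inE.
split=> //.
- apply: (@star_connected _ x) => // y; rewrite inE => /connectP[p ep ->].
  have [ep' sp] := inside_walk ep.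
  apply: (walk_connect ep'); last exact: mem_last.
  by move=> z zp; rewrite inE; exact: path_connect ep _ zp.
- by rewrite disjoint_sym; apply/disjointP.
move=> u v uC uv vX; have := out u uC; move: uC; rewrite !inE => xu uX.
by apply: connect_trans xu (connect1 _); rewrite /inside /= !inE uX vX.
Qed.

End Connected.

(** * Brambles *)

Section Bramble.
Variable G : sgraph.
Implicit Types (B : {set {set G}}) (S U W X : {set G}) (x y z : G) (p : seq G).

Definition bramble B :=
  (forall U, U \in B -> connected_set U) /\
  {in B &, forall U W, touch U W}.

Definition covers X B := [forall U in B, ~~ [disjoint X & U]].

Lemma coversP {X B} :
  reflect (forall U, U \in B -> exists2 x, x \in X & x \in U) (covers X B).
Proof.
apply: (iffP forall_inP) => h U /h; first by case/pred0Pn=> x /andP[]; exists x.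
by case=> x xX xU; apply/pred0Pn; exists x; rewrite /= xX.
Qed.

Lemma coversPn {X B} :
  reflect (exists2 U, U \in B & [disjoint X & U]) (~~ covers X B).
Proof.
rewrite negb_forall_in; apply: (iffP exists_inP) => [] [U UB XU]; exists U => //.
  by rewrite negbK in XU.
by rewrite negbK.
Qed.

End Bramble.

(** * Rooted tree decompositions *)

Section Rooted.
Variable G : sgraph.
Implicit Types (Z A : {set G}) (F : {set {set G}}) (u v : G).

Definition no_cross A A' :=
  forall u v, u \in A -> u \notin A' -> v \in A' -> v \notin A -> ~~ edge u v.

(** The arguments are the bag of the root, the set of all bags and the union of
    the bags.  [RootedJoin] hangs the second decomposition under the root of the
    first, so that every rooted tree is built by adding the subtrees of the
    children one after the other. *)
Inductive rooted_td : {set G} -> {set {set G}} -> {set G} -> Prop :=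
| RootedLeaf Z : rooted_td Z [set Z] Z
| RootedJoin Z F A Z' F' A' :
    rooted_td Z F A -> rooted_td Z' F' A' ->
    A :&: A' \subset Z :&: Z' -> no_cross A A' ->
    rooted_td Z (F :|: F') (A :|: A').

Lemma rooted_bags Z F A : rooted_td Z F A ->
  Z \in F /\ forall Y, Y \in F -> Y \subset A.
Proof.
elim=> {Z F A} [Z|Z F A Z' F' A' _ [ZF FA] _ [ZF' FA'] _ _].
  by rewrite inE; split=> // Y /set1P->.
split=> [|Y]; first by rewrite inE ZF.
by rewrite inE => /orP[/FA|/FA'] YA; rewrite subsetU ?YA ?orbT.
Qed.

Lemma no_cross_sym A A' : no_cross A A' -> no_cross A' A.
Proof. by move=> h u v uA' uA vA vA'; rewrite edge_sym; exact: h. Qed.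

(** A subtree may also be hung under a bag that is not the root: push it down to
    the branch that contains the bag. *)
Lemma rooted_attach Z F A Y Z' F' A' :
    rooted_td Z F A -> Y \in F -> rooted_td Z' F' A' ->
    A :&: A' \subset Y :&: Z' -> no_cross A A' ->
  rooted_td Z (F :|: F') (A :|: A').
Proof.
move=> td YF td' sAA' ncAA'; elim: td YF sAA' ncAA' => {Z F A}.
  by move=> Z /set1P-> sAA' nc; apply: RootedJoin sAA' nc => //; exact: RootedLeaf.
move=> Z1 F1 A1 Z2 F2 A2 td1 IH1 td2 IH2 s12 nc12 YF sAA' ncAA'.
have [ZF1 FA1] := rooted_bags td1; have [ZF2 FA2] := rooted_bags td2.
have sub u : u \in A1 :|: A2 -> u \in A' -> (u \in Y) && (u \in Z').
  by move=> uA uA'; have /subsetP/(_ u) := sAA'; rewrite !inE -in_setU uA uA'; apply.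
have sub1 u : u \in A1 -> u \in A' -> u \in Y.
  by move=> u1 u'; have /subsetP/(_ u) := sAA'; rewrite !inE u1 u' => /(_ isT)/andP[].
have sub2 u : u \in A2 -> u \in A' -> u \in Y.
  by move=> u1 u'; have /subsetP/(_ u) := sAA'; rewrite !inE u1 u' orbT => /(_ isT)/andP[].
have sub12 u : u \in A1 -> u \in A2 -> (u \in Z1) && (u \in Z2).
  by move=> uA uA'; have /subsetP/(_ u) := s12; rewrite !inE uA uA'; apply.
move: YF; rewrite inE => /orP[YF|YF].
  have YA := subsetP (FA1 _ YF).
  rewrite [F1 :|: F2 :|: F']setUAC [A1 :|: A2 :|: A']setUAC.
  apply: RootedJoin td2 _ _; first apply: IH1 => //.
  - by apply/subsetP=> u /setIP[u1 u']; rewrite inE; apply: sub; rewrite // inE u1.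
  - move=> u v u1 u' v' v1; apply: ncAA' => //; first by rewrite inE u1.
    rewrite inE negb_or v1 /=; apply: contra v1 => v2; exact: YA (sub2 _ v2 v').
  - apply/subsetP=> u; rewrite inE => /andP[+ u2]; rewrite inE => /orP[u1|u'].
      by rewrite inE sub12.
    rewrite inE sub12 //; exact: YA (sub2 _ u2 u').
  move=> u v; rewrite !inE negb_or => u1' u2 v2 /andP[v1 v'].
  have [u1|u1] := boolP (u \in A1); first exact: nc12.
  rewrite (negPf u1) /= in u1'; apply: (no_cross_sym ncAA') => //.
    by rewrite inE negb_or u1.
  by rewrite inE v2 orbT.
have YA := subsetP (FA2 _ YF).
rewrite -[F1 :|: F2 :|: F']setUA -[A1 :|: A2 :|: A']setUA.
apply: RootedJoin td1 _ _ _; first apply: IH2 => //.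
- by apply/subsetP=> u /setIP[u1 u']; rewrite inE; apply: sub; rewrite // inE u1 orbT.
- move=> u v u1 u' v' v1; apply: ncAA' => //; first by rewrite inE u1 orbT.
  rewrite inE negb_or v1 andbT; apply: contra v1 => v2; exact: YA (sub1 _ v2 v').
- apply/subsetP=> u; rewrite !inE => /andP[u1 /orP[u2|u']].
    exact: sub12.
  apply: sub12 => //; exact: YA (sub1 _ u1 u').
move=> u v u1; rewrite !inE negb_or => /andP[u2 u'] v2' v1.
have [v2|v2] := boolP (v \in A2); first exact: nc12.
rewrite (negPf v2) /= in v2'; apply: ncAA' => //; first by rewrite inE u1.
by rewrite inE negb_or v1.
Qed.

(** A join is symmetric in the two roots up to exchanging parent and child, so
    the root can be moved across one edge of the tree at a time. *)
Lemma rooted_reroot Z F A Y : rooted_td Z F A -> Y \in F -> rooted_td Y F A.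
Proof.
move=> td; elim: td Y => {Z F A} [Z Y /set1P->|]; first exact: RootedLeaf.
move=> Z1 F1 A1 Z2 F2 A2 td1 IH1 td2 IH2 s12 nc12 Y.
have [ZF1 _] := rooted_bags td1; have [ZF2 _] := rooted_bags td2.
rewrite inE => /orP[/IH1|/IH2] td.
  exact: rooted_attach td ZF1 td2 s12 nc12.
rewrite setUC [A1 :|: A2]setUC; apply: rooted_attach td ZF2 td1 _ _.
  by rewrite setIC [Z2 :&: Z1]setIC.
exact: no_cross_sym.
Qed.

End Rooted.


(** * Duality *)

Ltac set_cases := apply/setP=> ?; rewrite !inE; repeat case: (_ \in _) => //=.

Section Duality.
Variable G : sgraph.
Implicit Types (B F : {set {set G}}) (A C R S U W X Y Z : {set G}).
Implicit Types (x y z u v : G) (p q : seq G).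

(** This holds when [Z] is the bag of a node and [A] is the union of the bags in
    the subtree below that node. *)
Definition frontier Z A := forall u v, u \in A -> u \notin Z -> v \notin A -> ~~ edge u v.

(** Given a decomposition rooted at the bag [R], one for the graph induced on
    [X :|: C] is obtained by restricting all bags to [C] and by adding each
    vertex of [X] to all the bags on the way from its own bags to the root.  In
    terms of subtrees, the bag [Z] of a node whose subtree has the union [A]
    turns into [(Z :&: C) :|: (X :&: A)].  The set [Y] stands for the vertices
    of [X] that come from children of the root still to be added: the bag of a
    node is known to be good only once all its children are there. *)
Lemma rooted_shift X C R (good : {set G} -> Prop) Z F A :
    [disjoint X & C] -> rooted_td Z F A -> frontier Z A ->
    R :&: A \subset Z ->
    (forall Z' A', Z' \in F -> Z' \subset A' -> frontier Z' A' -> R :&: A' \subset Z' ->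
       good ((Z' :&: C) :|: (X :&: A'))) ->
  forall Y, Y \subset X -> good ((Z :&: C) :|: (X :&: A) :|: Y) ->
  exists F', rooted_td ((Z :&: C) :|: (X :&: A) :|: Y) F' ((A :&: (X :|: C)) :|: Y) /\
    forall W, W \in F' -> good W.
Proof.
move=> /disjointP dXC; elim=> {Z F A}.
  move=> Z _ _ _ Y _ gY; exists [set (Z :&: C) :|: (X :&: Z) :|: Y]; split; last by move=> W /set1P->.
  have -> : (Z :&: (X :|: C)) :|: Y = (Z :&: C) :|: (X :&: Z) :|: Y.
    by rewrite setIUr [Z :&: X]setIC [_ :|: (Z :&: C)]setUC.
  exact: RootedLeaf.
move=> Z F A Z' F' A' td IH td' IH' /subsetP sAA' nc fr RZ node Y YX gY.
have [ZF FA] := rooted_bags td; have [ZF' FA'] := rooted_bags td'.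
have ZA := subsetP (FA _ ZF); have ZA' := subsetP (FA' _ ZF').
have sub u : u \in A -> u \in A' -> (u \in Z) /\ (u \in Z').
  by move=> uA uA'; have := sAA' u; rewrite !inE uA uA' => /(_ isT)/andP.
have fr1 : frontier Z A.
  move=> u v uA uZ vA; have [vA'|vA'] := boolP (v \in A'); last first.
    by apply: fr; rewrite ?inE ?uA // negb_or vA.
  by apply: nc => //; apply: contra uZ => uA'; case: (sub u).
have notZ u : u \in A' -> u \notin Z' -> u \notin Z.
  by move=> uA' uZ'; apply: contra uZ' => /ZA uA; case: (sub u).
have fr2 : frontier Z' A'.
  move=> u v uA' uZ' vA'; have uZ := notZ u uA' uZ'.
  have [vA|vA] := boolP (v \in A); last first.
    by apply: fr; rewrite ?inE ?uA' ?orbT // negb_or vA.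
  by apply: (no_cross_sym nc) => //; apply: contra uZ' => uA; case: (sub u).
have RZ1 : R :&: A \subset Z.
  apply: subset_trans RZ; apply/subsetP=> u; rewrite !inE => /andP[-> ->] //.
have RZ2 : R :&: A' \subset Z'.
  apply/subsetP=> u /setIP[uR uA']; apply/negPn/negP=> uZ'.
  have := notZ u uA' uZ'; rewrite (subsetP RZ) // !inE uR uA' orbT //.
have Y1X : Y :|: (X :&: A') \subset X by rewrite subUset YX subsetIl.
have [||T1 [td1 g1]] := IH fr1 RZ1 _ _ Y1X.
- by move=> Z0 A0 Z0F; apply: node; rewrite inE Z0F.
- have -> // : (Z :&: C) :|: (X :&: A) :|: (Y :|: (X :&: A')) =
    (Z :&: C) :|: (X :&: (A :|: A')) :|: Y by set_cases.
have [||T2 [td2 g2]] := IH' fr2 RZ2 _ set0 (sub0set _).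
- by move=> Z0 A0 Z0F; apply: node; rewrite inE Z0F orbT.
- rewrite setU0; apply: node => //; first by rewrite inE ZF' orbT.
  exact/subsetP.
rewrite !setU0 in td2.
exists (T1 :|: T2); split; last by move=> W; rewrite inE => /orP[/g1|/g2].
have -> : (Z :&: C) :|: (X :&: (A :|: A')) :|: Y =
    (Z :&: C) :|: (X :&: A) :|: (Y :|: (X :&: A')) by set_cases.
have -> : ((A :|: A') :&: (X :|: C)) :|: Y =
    ((A :&: (X :|: C)) :|: (Y :|: (X :&: A'))) :|: (A' :&: (X :|: C)) by set_cases.
apply: RootedJoin td1 td2 _ _.
  apply/subsetP=> u; rewrite !inE => /andP[u1 /andP[uA' uXC]].
  have [uX|uX] := boolP (u \in X); first by rewrite uA' !orbT.
  have uC : u \in C by rewrite (negPf uX) in uXC.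
  have uA : u \in A.
    by move: u1; rewrite (negPf uX) /= orbF => /orP[/andP[]//|/(subsetP YX)]; rewrite (negPf uX).
  by have [-> ->] := sub u uA uA'; rewrite uC.
move=> u v; rewrite !inE => u1 u2 v1 v2.
have vX : v \notin X by apply: contra v2 => vX; move: v1; rewrite vX /= andbT => ->; rewrite !orbT.
have [vA' vC] : v \in A' /\ v \in C by move: v1; rewrite (negPf vX) => /andP.
have vA : v \notin A by apply: contra v2 => ->; rewrite vC orbT.
have [uA|uA] := boolP (u \in A).
  have [uA'|uA'] := boolP (u \in A'); last exact: nc.
  have [_ uZ'] := sub u uA uA'; case/negP: u2.
  by rewrite uA' /=; case/orP: u1 => [/andP[]//|/orP[/(subsetP YX)|/andP[]] -> //].
have uX : u \in X.
  by move: u1; rewrite (negPf uA) /= => /orP[/(subsetP YX)|/andP[]].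
rewrite edge_sym; apply: fr; rewrite ?inE ?vA' ?orbT //.
  by apply: contra vA; apply: ZA.
by rewrite (negPf uA) /=; apply: contra u2 => ->; rewrite uX.
Qed.

Definition fair k B W := (#|W| <= k) || ~~ covers W B.

(** In a decomposition rooted at [R], a walk leading to [R] leaves the subtree of
    a node through the bag of that node. *)
Lemma walk_frontier Z A R x p :
    frontier Z A -> R :&: A \subset Z -> path (@edge G) x p -> x \in A ->
    last x p \in R -> exists2 y, y \in x :: p & y \in Z.
Proof.
move=> fr /subsetP RZ; elim: p x => [|z p IH] x /=.
  by move=> _ xA xR; exists x; rewrite ?mem_head // RZ // inE xR.
case/andP=> xz ep xA lR; have [xZ|xZ] := boolP (x \in Z).
  by exists x; rewrite ?mem_head.
have zA : z \in A by apply/negPn/negP=> zA; case/negP: (fr x z xA xZ zA).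
by have [y yp yZ] := IH z ep zA lR; exists y; rewrite // inE yp orbT.
Qed.

Lemma walk_closed X C y p :
    (forall u v, u \in C -> edge u v -> v \notin X -> v \in C) ->
    path (@edge G) y p -> {in p, forall z, z \notin X} -> y \in C -> last y p \in C.
Proof.
move=> clC; elim: p y => //= z p IH y /andP[yz ep] pX yC.
apply: IH => // [w wp|]; first by apply: pX; rewrite inE wp orbT.
by apply: clC yC yz _; apply: pX; rewrite mem_head.
Qed.

(** A vertex of [X] that is added to the bag [Z] starts a path to [R] of the
    linkage, and this path has to cross [Z] in a vertex outside [X :|: C], which
    is removed from the bag.  Different paths are disjoint, so at least as many
    vertices are removed as are added. *)
Lemma shifted_card X C R Z A :
    [disjoint X & C] -> [disjoint R & C] ->
    (forall u v, u \in C -> edge u v -> v \notin X -> v \in C) ->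
    linked (@edge G) X R #|X| ->
    Z \subset A -> frontier Z A -> R :&: A \subset Z ->
  #|(Z :&: C) :|: (X :&: A)| <= #|Z|.
Proof.
move=> /disjointP dXC /disjointP dRC clC [a [p lk]] ZA fr RZ.
have [aX pR ep up disj] := lk.
pose D := X :&: (A :\: Z).
have [h hP] : exists h : G -> G, forall x, x \in D ->
    [/\ h x \in Z, h x \notin X, h x \notin C & exists i, a i = x /\ h x \in p i].
  apply: (@fin_all_exists _ (fun=> G) (fun x y => x \in D -> [/\ y \in Z, y \notin X,
    y \notin C & exists i, a i = x /\ y \in p i])) => x.
  have [xD|_] := boolP (x \in D); last by exists x.
  move: xD; rewrite !inE => /andP[xX /andP[xZ xA]].
  have [i ai] := linkage_starts lk erefl xX.
  have [|y yp yZ] := walk_frontier fr RZ (ep i) _ (pR i); first by rewrite ai.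
  have {}yp : y \in p i.
    by move: yp; rewrite inE ai; case: eqP => // yx; rewrite -yx yZ in xZ.
  have pX z : z \in p i -> z \notin X.
    move=> zp; apply/negP=> zX.
    have zi : z \in a i :: p i by rewrite inE zp orbT.
    by move: (up i); rewrite -(linkage_start_only lk erefl zi zX) /= zp.
  exists y => _; split=> //; first exact: pX; last by exists i.
  apply/negP=> yC; have := dRC _ (pR i); apply/negP/negPn.
  move: (ep i) pX; case/splitPr: yp => p1 p2; rewrite cat_path last_cat /=.
  case/and3P=> _ _ ep2 pX; apply: walk_closed clC ep2 _ yC => z zp.
  by apply: pX; rewrite mem_cat inE zp !orbT.
have cD : #|D| <= #|Z :\: (X :|: C)|.
  rewrite -(card_in_imset (f := h)); last first.
    move=> x y /hP[_ _ _ [i [<- hi]]] /hP[_ _ _ [j [<- hj]]] hij.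
    by rewrite (disj i j (h (a i))) // inE ?hi ?hij ?hj orbT.
  apply/subset_leq_card/subsetP=> _ /imsetP[x /hP[hZ hX hC _] ->].
  by rewrite !inE hZ (negPf hX) (negPf hC).
rewrite -(cardsID (X :|: C) Z); apply: leq_trans (leq_add (leqnn _) cD).
apply: leq_trans (leq_card_setU _ _).1; apply/subset_leq_card/subsetP=> u.
rewrite !inE; case: (u \in Z); case: (u \in C); case: (u \in X); case: (u \in A) => //=.
Qed.

(** If [C |: B] is not a bramble, some element of [B] does not touch [C], and the
    bag consisting of [C] and its neighbours in [X] is fair by itself.  Otherwise
    a decomposition that is fair for [C |: B] but not for [B] has a large bag [R]
    that covers [B] and misses [C].  Since [X] is a smallest cover, there are
    [#|X|] disjoint paths from [X] to [R], and shifting towards [R] turns the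
    bag [R] into [X].  A shifted bag that is large meets [C], as [X] is small;
    so does the bag it comes from, which therefore misses an element of [B], and
    the shifted bag misses the same element. *)
Lemma component_td k B X C :
    bramble B -> covers X B -> (forall S, covers S B -> #|X| <= #|S|) -> #|X| <= k ->
    connected_set C -> [disjoint X & C] ->
    (forall u v, u \in C -> edge u v -> v \notin X -> v \in C) ->
    (bramble (C |: B) ->
      exists Z F, rooted_td Z F setT /\ forall Y, Y \in F -> fair k (C |: B) Y) ->
    ~ (exists Z F, rooted_td Z F setT /\ forall Y, Y \in F -> fair k B Y) ->
  exists F, rooted_td X F (X :|: C) /\ forall Y, Y \in F -> fair k B Y.
Proof.
move=> [cB tB] covX minX Xk cC dXC clC IH noB.
have XC := disjointP dXC.
have fairX : fair k B X by rewrite /fair Xk.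
have [bC|nbC] := boolp.pselect (bramble (C |: B)); last first.
  have [U UB ntU] : exists2 U, U \in B & ~~ touch C U.
    apply: boolp.contrapT => noU; apply: nbC.
    have tC U : U \in B -> touch C U.
      by move=> UB; have [//|nt] := boolP (touch C U); case: noU; exists U.
    split=> [U /setU1P[-> //|/cB //]|U W /setU1P[->|UB] /setU1P[->|WB]].
    - have [/set0Pn[x xC] _] := cC.
      by apply/touchP; exists x, x; split=> //; left.
    - exact: tC.
    - by rewrite touch_sym; exact: tC.
    - exact: tB.
  pose N := [set x in X | [exists y in C, edge x y]].
  exists ([set X] :|: [set C :|: N]); split; last first.
    move=> Y; rewrite !inE => /orP[/eqP-> //|/eqP->].
    rewrite /fair orbC; apply/orP; left; apply/coversPn; exists U => //.
    apply/disjointP=> x xCN; apply: contra ntU => xU; apply/touchP.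
    move: xCN; rewrite !inE => /orP[xC|/andP[_ /existsP[y /andP[yC xy]]]].
      by exists x, x; split=> //; left.
    by exists y, x; split=> //; right; rewrite edge_sym.
  have -> : X :|: C = X :|: (C :|: N).
    by apply/setP=> x; rewrite !inE; case: (x \in X); case: (x \in C).
  apply: RootedJoin; try exact: RootedLeaf.
    exact: subxx.
  move=> u v uX; rewrite !inE uX /= negb_or => /andP[_ /existsPn uC] + vX.
  by rewrite (negPf vX) orbF => vC; move: (uC v); rewrite vC.
have [Z [F [td fairF]]] := IH bC.
have [R [RF kR covR]] : exists R, [/\ R \in F, k < #|R| & covers R B].
  apply: boolp.contrapT => noR; apply: noB; exists Z, F; split=> // Y YF.
  rewrite /fair leqNgt -negb_and; apply/negP=> /andP[kY cY].
  by apply: noR; exists Y.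
have dRC : [disjoint R & C].
  have := fairF R RF; rewrite /fair leqNgt kR /= => /coversPn[U].
  rewrite in_setU1 => /predU1P[-> //|UB dRU].
  by move/coversP: covR => /(_ U UB)[x xR]; rewrite (negPf (disjointP dRU x xR)).
have {}td := rooted_reroot td RF.
have lk : linked (@edge G) X R #|X|.
  apply: menger => S sepS; apply: minX; apply/coversP=> U UB.
  have [x xX xU] := coversP covX U UB; have [y yR yU] := coversP covR U UB.
  have [p [ep lp sp]] := connected_walk (cB U UB) xU yU.
  have [|z zp zS] := sepS x p xX ep; first by rewrite lp.
  by exists z => //; apply: sp.
have [||//||F' []] := @rooted_shift X C R (fair k B) R F setT dXC td _ _ _ set0 (sub0set _).
- by move=> u v; rewrite !inE.
- by rewrite setIT.
- move=> Z' A' Z'F Z'A' fr RZ'; rewrite /fair; set W := _ :|: _.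
  have [//|kW] := leqP; rewrite orFb.
  have WZ : #|W| <= #|Z'| by apply: (shifted_card dXC dRC clC lk).
  have := fairF Z' Z'F; rewrite /fair leqNgt (leq_trans kW WZ) orFb.
  have [w wZ wC] : exists2 w, w \in Z' & w \in C.
    apply: boolp.contrapT => now; move: kW; apply/negP; rewrite -leqNgt.
    apply: leq_trans Xk; apply/subset_leq_card/subsetP=> u; rewrite !inE.
    case/orP=> /andP[] // uZ uC; by case: now; exists u.
  case/coversPn=> U; rewrite in_setU1 => /predU1P[->|UB] /disjointP dU.
    by have := dU w wZ; rewrite wC.
  apply/coversPn; exists U => //; apply/disjointP=> u; rewrite !inE.
  case/orP=> /andP[]; first by move=> uZ _; exact: dU.
  move=> uX uA; apply/negP=> uU.
  have [r rR rU] := coversP covR U UB.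
  have [p [ep lp sp]] := connected_walk (cB U UB) uU rU.
  have [|y yp yZ] := walk_frontier fr RZ' ep uA; first by rewrite lp.
  by have := dU y yZ; rewrite sp.
- rewrite setU0 setIT; have -> : R :&: C = set0; last by rewrite set0U.
  by apply/eqP; rewrite setI_eq0.
rewrite !setU0 setIT setTI => td' fF'; exists F'; split=> //.
by move: td'; have -> : R :&: C = set0; [apply/eqP; rewrite setI_eq0|rewrite set0U].
Qed.

(** For every bramble [B] there is a decomposition all of whose bags of size more
    than [k] fail to cover [B]; for the empty bramble, which is covered by
    anything, this bounds the size of all bags.  The proof is by induction on the
    number of connected sets that can still be added to [B]: take a smallest
    cover [X] of [B], decompose each component of [G - X] together with [X], and
    glue these decompositions along their common root [X]. *)
Theorem bramble_duality k :
    (forall B, bramble B -> exists2 X, covers X B & #|X| <= k) ->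
  exists Z F, @rooted_td G Z F setT /\ forall Y, Y \in F -> #|Y| <= k.
Proof.
move=> hB.
suff main n B : #|~: B| < n -> bramble B ->
    exists Z F, @rooted_td G Z F setT /\ forall Y, Y \in F -> fair k B Y.
  have [|Z [F [td fF]]] := main #|~: (set0 : {set {set G}})|.+1 set0 (ltnSn _).
    by split=> U; rewrite inE.
  exists Z, F; split=> // Y /fF; rewrite /fair => /orP[//|/coversPn[U]].
  by rewrite inE.
elim: n B => // n IH B; rewrite ltnS => leB bB.
apply: boolp.contrapT => noB.
have [X0 covX0 X0k] := hB B bB.
have [X [covX minX]] : exists X : {set G},
    covers X B /\ forall S, covers S B -> #|X| <= #|S|.
  by case: (@arg_minnP _ X0 (fun X => covers X B) (fun X => #|X|) covX0) => X; exists X.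
have Xk := leq_trans (minX _ covX0) X0k.
have glue (s : seq G) : exists A F, [/\ rooted_td X F A, forall Y, Y \in F -> fair k B Y,
    {subset s <= A} & forall u v, u \in A -> u \notin X -> edge u v -> v \in A].
  elim: s => [|x s [A [F [td fF sA clA]]]].
    exists X, [set X]; split=> //; first exact: RootedLeaf.
      by move=> Y /set1P->; rewrite /fair Xk.
    by move=> u v ->.
  have [xA|xA] := boolP (x \in A).
    by exists A, F; split=> // y; rewrite inE => /predU1P[->|/sA].
  have [XF FA] := rooted_bags td; have XA := subsetP (FA _ XF).
  have xX : x \notin X by apply: contra xA; apply: XA.
  have [] := componentP xX; move: (component X x) => C xC cC dXC clC.
  have outC u : u \in A -> u \notin X -> u \notin C.
    move=> uA uX; apply/negP=> uC; case/negP: xA.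
    have [p [ep <- sp]] := connected_walk cC uC xC.
    elim: p u uA uX ep sp {uC} => //= y p IHp u uA uX /andP[uy ep] sp.
    apply: IHp => //; first exact: clA uX uy.
      by apply/negP=> yX; have := disjointP dXC y yX; rewrite sp // !inE eqxx orbT.
    by move=> z zp; apply: sp; rewrite inE zp orbT.
  have [F' [td' fF']] : exists F', rooted_td X F' (X :|: C) /\ forall Y, Y \in F' -> fair k B Y.
    apply: (component_td bB covX minX Xk cC dXC clC _ noB).
    apply: IH; apply: leq_trans leB; apply: proper_card; apply/properP; split.
      by rewrite setCS subsetUr.
    exists C; rewrite !inE ?eqxx //; apply/negP=> CB.
    by have [y yX] := coversP covX C CB; rewrite (negPf (disjointP dXC y yX)).
  exists (A :|: (X :|: C)), (F :|: F'); split.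
  - apply: RootedJoin td td' _ _.
      apply/subsetP=> u; rewrite !inE => /andP[uA /orP[-> //|uC]].
      by have := contraTT (outC u uA) uC => ->.
    move=> u v uA; rewrite !inE negb_or => /andP[uX uC] _ vA.
    by apply: contra vA; exact: clA.
  - by move=> Y; rewrite inE => /orP[/fF|/fF'].
  - by move=> y; rewrite !inE => /predU1P[->|/sA ->]; rewrite ?xC ?orbT.
  move=> u v; rewrite !inE => /orP[uA uX uv|/orP[-> //|uC _ uv]].
    by rewrite (clA u v).
  apply/or3P; have [vX|vX] := boolP (v \in X); first exact: Or32.
  exact: Or33 (clC u v uC uv vX).
have [A [F [td fF sA _]]] := glue (enum G).
apply: noB; exists X, F; split=> //.
by have <- : A = setT by apply/setP=> u; rewrite inE sA // mem_enum.
Qed.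

End Duality.


(** * Rooted tree decompositions as tree decompositions *)

Section ParentTree.
Variables (T : finType) (r : T) (par : T -> T) (rk : T -> nat).
Hypothesis rk_par : forall t, t != r -> rk (par t) < rk t.

Definition parent_edge : rel T :=
  [rel s t | (s != r) && (par s == t) || (t != r) && (par t == s)].

Lemma parent_edge_sym : symmetric parent_edge.
Proof. by move=> s t; apply: orbC. Qed.

Lemma parent_edge_irr : irreflexive parent_edge.
Proof.
move=> t; rewrite /parent_edge /= orbb; apply/negP=> /andP[/rk_par + /eqP pt].
by rewrite pt ltnn.
Qed.

Definition parent_tree := SGraph parent_edge_sym parent_edge_irr.

(** A set of nodes is connected when it has a highest node [top] and contains the
    parent of each of its other nodes. *)
Lemma parent_star (S : {set parent_tree}) top :
    top \in S -> (forall t, t \in S -> t != top -> (t != r) && (par t \in S)) ->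
  connected_set S.
Proof.
move=> topS parS; apply: (star_connected topS) => t.
have [n] := ubnP (rk t); elim: n t => // n IH t; rewrite ltnS => le_n tS.
have [->|tn] := eqVneq t top; first exact: connect0.
have /andP[tr ptS] := parS t tS tn.
have lt_n : rk (par t) < n := leq_trans (rk_par tr) le_n.
apply: (connect_trans (IH (par t) lt_n ptS)); apply: connect1.
by rewrite /inside /= ptS tS /parent_edge /= tr eqxx orbT.
Qed.

(** In a cycle, the two neighbours of a node of largest rank would both have to
    be its parent. *)
Lemma parent_is_tree : is_tree parent_tree.
Proof.
split; first by apply: (@parent_star _ r) => [|t _ ->]; rewrite inE.
move=> c uc; rewrite leqNgt; apply/negP=> sc.
have [t0 t0c] : exists t, t \in c by case: c sc {uc} => // t c _; exists t; rewrite mem_head.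
have [t tc maxt] := @arg_maxnP _ t0 (mem c) rk t0c.
have nb u : u \in c -> parent_edge t u -> u = par t.
  move=> uinc /orP[/andP[_ /eqP //]|/andP[/rk_par + /eqP pu]].
  by rewrite pu ltnNge; move/negP; case; exact: maxt.
have [i s rs] := rot_to tc.
have : ucycle parent_edge (t :: s) by rewrite -rs rot_ucycle.
have ins u : u \in s -> u \in c by move=> us; rewrite -(mem_rot i) rs inE us orbT.
have : 2 < size (t :: s) by rewrite -rs size_rot.
case: s rs ins => [|u [|w s]] //= rs ins _ /andP[/= /andP[tu /andP[_ pth]] /and3P[_ us _]].
move: pth; rewrite rcons_path => /andP[_ lt].
have lw : last w s \in w :: s := mem_last w s.
case/negP: us; rewrite (nb u _ tu) -?(nb (last w s)) ?mem_head //.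
- by apply: ins; rewrite inE lw orbT.
- by rewrite parent_edge_sym.
- by apply: ins; rewrite mem_head.
Qed.

End ParentTree.

Section Layout.
Variable G : sgraph.
Implicit Types (Z A : {set G}) (F : {set {set G}}) (u v : G).

(** That the nodes whose bags contain a given vertex form a subtree is expressed
    by a highest such node, in the form needed for [parent_star]. *)
Record layout (T : finType) (r : T) (par : T -> T) (rk : T -> nat)
    (bag : T -> {set G}) Z F A : Prop := Layout {
  layout_rk : forall t, t != r -> rk (par t) < rk t;
  layout_root : bag r = Z;
  layout_bag : forall t, bag t \in F;
  layout_edge : forall u v, u \in A -> v \in A -> edge u v ->
    exists t, (u \in bag t) && (v \in bag t);
  layout_top : forall v, v \in A -> exists2 top, v \in bag top &
    forall t, v \in bag t -> t != top -> (t != r) && (v \in bag (par t)) }.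

Lemma rooted_layout Z F A : rooted_td Z F A ->
  exists (T : finType) (r : T) par rk bag, layout r par rk bag Z F A.
Proof.
elim=> {Z F A} [Z|Z F A Z' F' A' td1 [T1 [r1 [par1 [rk1 [bag1 L1]]]]] td2
                  [T2 [r2 [par2 [rk2 [bag2 L2]]]]] /subsetP sAA' nc].
  exists unit, tt, id, (fun=> 0), (fun=> Z); split=> //.
  - by move=> _; rewrite inE.
  - by move=> u v uZ vZ _; exists tt; rewrite uZ.
  - by move=> v vZ; exists tt => // -[] _ /eqP.
have [_ sub1] := rooted_bags td1; have [_ sub2] := rooted_bags td2.
have inA1 v t : v \in bag1 t -> v \in A := subsetP (sub1 _ (layout_bag L1 t)) v.
have inA2 v t : v \in bag2 t -> v \in A' := subsetP (sub2 _ (layout_bag L2 t)) v.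
pose par (t : T1 + T2) : T1 + T2 := match t with
  | inl t1 => inl (par1 t1)
  | inr t2 => if t2 == r2 then inl r1 else inr (par2 t2) end.
pose rk (t : T1 + T2) := match t with
  | inl t1 => rk1 t1 | inr t2 => (rk1 r1 + rk2 t2).+1 end.
pose bag (t : T1 + T2) := match t with inl t1 => bag1 t1 | inr t2 => bag2 t2 end.
exists (T1 + T2)%type, (inl r1), par, rk, bag; split.
- case=> [t1|t2] /= tr; first exact: layout_rk L1 _ tr.
  case: eqP => [_|/eqP t2r] /=; first by rewrite ltnS leq_addr.
  by rewrite ltnS ltn_add2l; exact: layout_rk L2 _ t2r.
- exact: layout_root L1.
- by case=> [t1|t2] /=; rewrite inE ?(layout_bag L1) ?(layout_bag L2) ?orbT.
- move=> u v uA vA uv.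
  have [/andP[u1 v1]|h1] := boolP ((u \in A) && (v \in A)).
    by have [t] := layout_edge L1 u1 v1 uv; exists (inl t).
  have [/andP[u2 v2]|h2] := boolP ((u \in A') && (v \in A')).
    by have [t] := layout_edge L2 u2 v2 uv; exists (inr t).
  move: uA vA; rewrite !inE => uA vA.
  have [u1|u1] := boolP (u \in A).
    have v1 : v \notin A by apply: contra h1 => ->; rewrite u1.
    have v2 : v \in A' by rewrite (negPf v1) in vA.
    have u2 : u \notin A' by apply: contra h2 => ->; rewrite v2.
    by have := nc u v u1 u2 v2 v1; rewrite uv.
  have u2 : u \in A' by rewrite (negPf u1) in uA.
  have v2 : v \notin A' by apply: contra h2 => ->; rewrite u2.
  have v1 : v \in A by rewrite (negPf v2) orbF in vA.
  by have := nc v u v1 v2 u2 u1; rewrite edge_sym uv.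
move=> v vA; have [v1|v1] := boolP (v \in A); last first.
  have v2 : v \in A' by rewrite inE (negPf v1) in vA.
  have [top vt topP] := layout_top L2 v2; exists (inr top) => // -[t1 /inA1|t2 /= vt2 ttop].
    by rewrite (negPf v1).
  have {}ttop : t2 != top by apply: contraNneq ttop => ->.
  by have /andP[t2r vp] := topP t2 vt2 ttop; rewrite (negPf t2r).
have [top vt topP] := layout_top L1 v1; exists (inl top) => // -[t1|t2] /= vt12 ttop.
  by apply: topP => //; apply: contraNneq ttop => ->.
have v2 := inA2 _ _ vt12.
have := sAA' v; rewrite !inE v1 v2 => /(_ isT)/andP[vZ vZ'].
have [top2 vt2 topP2] := layout_top L2 v2.
have r2top : r2 = top2.
  apply/eqP/negPn/negP=> nr; have := topP2 r2 _ nr.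
  by rewrite (layout_root L2) eqxx => /(_ vZ').
case: eqP => [_|/eqP t2r] /=; first by rewrite (layout_root L1).
by have := topP2 t2 vt12; rewrite -r2top => /(_ t2r) /andP[].
Qed.

Lemma rooted_treewidth Z F k :
  rooted_td Z F [set: G] -> (forall Y, Y \in F -> #|Y| <= k) -> treewidth G <= k.-1.
Proof.
move=> /rooted_layout[T [r [par [rk [bag L]]]]] Fk.
pose TT := parent_tree (layout_rk L).
have wk : has_width G (width (bag : TT -> {set G})).
  exists TT, bag; split=> //; split.
  - exact: parent_is_tree.
  - by move=> v; have [t] := layout_top L (in_setT v); exists t.
  - by move=> u v; exact: (layout_edge L (in_setT u) (in_setT v)).
  move=> v; have [top vt topP] := layout_top L (in_setT v).
  apply: (@parent_star _ r _ _ (layout_rk L) _ top); first by rewrite inE.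
  by move=> t; rewrite !inE => vt' ttop; exact: topP.
rewrite /treewidth; case: ex_minnP => m _ minm.
apply: leq_trans (minm _ (boolp.asboolT wk)) _.
rewrite /width; have : \max_(t : TT) #|bag t| <= k.
  by apply/bigmax_leqP=> t _; apply: Fk; exact: layout_bag L t.
by lia.
Qed.

End Layout.

Theorem treewidth_bramble (G : sgraph) k : k < treewidth G ->
  exists B : {set {set G}}, bramble B /\ forall X, covers X B -> k.+1 < #|X|.
Proof.
move=> kG; apply: boolp.contrapT => noB.
have [|Z [F [td Fk]]] := @bramble_duality G k.+1; last first.
  by have := rooted_treewidth td Fk; rewrite leqNgt /= kG.
move=> B bB; apply: boolp.contrapT => noX; apply: noB; exists B; split=> // X cX.
by rewrite ltnNge; apply/negP=> Xk; apply: noX; exists X.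
Qed.


(** * Separating points in the plane *)

Section Points.
Variable I : finType.
Implicit Types (f g : I -> nat) (S T : {set I}) (i j : I) (m n t : nat).

Definition below f S t := [set i in S | f i < t].
Definition above f S t := [set i in S | t <= f i].
Definition before f S T := forall i j, i \in S -> j \in T -> f i < f j.

Lemma below_above f S t : #|below f S t| + #|above f S t| = #|S|.
Proof.
rewrite -(cardsID [set i | f i < t] S); congr (_ + _); apply: eq_card => i.
  by rewrite !inE.
by rewrite !inE -leqNgt andbC.
Qed.

Lemma disjoint_below_above f S t : [disjoint below f S t & above f S t].
Proof. by apply/pred0P=> i; rewrite /= !inE; case: ltnP => _; rewrite ?andbF. Qed.

Lemma below_sub f S t : below f S t \subset S.
Proof. by apply/subsetP=> i; rewrite inE => /andP[]. Qed.

Lemma above_sub f S t : above f S t \subset S.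
Proof. by apply/subsetP=> i; rewrite inE => /andP[]. Qed.

Lemma before_threshold f S T t : before f (below f S t) (above f T t).
Proof. by move=> i j; rewrite !inE => /andP[_ fi] /andP[_]; exact: leq_trans. Qed.

Lemma before_sub f S T S' T' :
  S' \subset S -> T' \subset T -> before f S T -> before f S' T'.
Proof. by move=> /subsetP sS /subsetP sT h i j /sS iS /sT jT; exact: h. Qed.

Lemma below_max f S : exists n, below f S n = S.
Proof.
exists (\max_i f i).+1; apply/setP=> i; rewrite inE ltnS.
by rewrite (leq_bigmax_cond (F := f)) // andbT.
Qed.

Lemma below0 f S : below f S 0 = set0.
Proof. by apply/setP=> i; rewrite !inE ltn0 andbF. Qed.

Lemma below_step f S t : injective f -> #|below f S t.+1| <= #|below f S t|.+1.
Proof.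
move=> fI; pose E := [set i in S | f i == t].
have cE : #|E| <= 1.
  by apply/card_le1_eqP=> i j; rewrite !inE => /andP[_ /eqP <-] /andP[_ /eqP /fI].
have -> : below f S t.+1 = below f S t :|: E.
  by apply/setP=> i; rewrite !inE ltnS leq_eqVlt orbC -andb_orr.
by apply: leq_trans (leq_card_setU _ _).1 _; rewrite -addn1 leq_add2l.
Qed.

(** Raising the threshold by one adds at most one point. *)
Lemma below_exact f S n : injective f -> n <= #|S| -> exists t, #|below f S t| = n.
Proof.
move=> fI le_n; have ex : exists t, n <= #|below f S t|.
  by have [t St] := below_max f S; exists t; rewrite St.
case: (ex_minnP ex) => -[|t] le_t mint; first by exists 0; move: le_t; rewrite below0 cards0; lia.
exists t.+1; apply/eqP; rewrite eqn_leq le_t andbT.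
apply: leq_trans (below_step _ _ fI) _; rewrite ltnNge.
by apply/negP=> /mint; rewrite ltnn.
Qed.

(** Raise the threshold [t] until [m2] points of [S2] lie below it.  If by then
    fewer than [m1] points of [S1] are left above, step back by one: the last
    point passed belongs to [S2], so [S1] is not affected. *)
Lemma sweep g S1 S2 m1 m2 :
    injective g -> [disjoint S1 & S2] -> 0 < m1 -> 0 < m2 ->
  exists t, (m2 <= #|below g S2 t|) && (m1 <= #|above g S1 t|) ||
            (#|below g S2 t| < m2) && (#|above g S1 t| < m1).
Proof.
move=> gI dS m1_gt0 m2_gt0.
have [leq2|lt2] := leqP m2 #|S2|; last first.
  have [t St] := below_max g S1; exists t; apply/orP; right.
  have := below_above g S1 t; rewrite St; have := subset_leq_card (below_sub g S2 t); lia.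
have ex : exists t, m2 <= #|below g S2 t|.
  by have [t St] := below_max g S2; exists t; rewrite St.
case: (ex_minnP ex) => -[|t] le_t mint; first by move: le_t; rewrite below0 cards0; lia.
have [le1|lt1] := leqP m1 #|above g S1 t.+1|; first by exists t.+1; rewrite le_t le1.
have ltt : #|below g S2 t| < m2 by rewrite ltnNge; apply/negP=> /mint; rewrite ltnn.
exists t; rewrite ltt /=; apply/orP; right; apply: leq_ltn_trans lt1.
have [/existsP[i /andP[i1 /eqP gi]]|/existsPn no] := boolP [exists i in S1, g i == t].
  have eqb : below g S2 t.+1 = below g S2 t.
    apply/setP=> j; rewrite !inE ltnS leq_eqVlt; case: eqP => //= gj.
    have ij : i = j by apply: gI; rewrite gi gj.
    by have := disjointFr dS i1; rewrite ij => ->.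
  by move: le_t; rewrite eqb leqNgt ltt.
apply/subset_leq_card/subsetP=> i; rewrite !inE => /andP[i1 ti].
by rewrite i1 ltn_neqAle ti andbT eq_sym; have := no i; rewrite i1.
Qed.

(** Cut [S] by [f] into two halves of at least [2 * m - 1] points each, and sweep
    with respect to [g].  Either outcome leaves [m] points in each half that are
    separated by [g]. *)
Lemma fat_pair f g S m : injective f -> injective g -> 0 < m -> m.*2.-1.*2 <= #|S| ->
  exists T1 T2, [/\ T1 \subset S, T2 \subset S, m <= #|T1|, m <= #|T2| & before f T1 T2] /\
    (before g T1 T2 \/ before g T2 T1).
Proof.
move=> fI gI m_gt0 cS; have [|s cL] := below_exact (n := m.*2.-1) fI (S := S).
  by move: cS; rewrite -!addnn; lia.
set L := below f S s in cL; set H := above f S s.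
have cH : m.*2.-1 <= #|H| by have := below_above f S s; rewrite -/L -/H; lia.
have LS := below_sub f S s; have HS := above_sub f S s.
have bf : before f L H by exact: before_threshold.
have dLH : [disjoint L & H] by exact: disjoint_below_above.
have [t /orP[/andP[tH tL]|/andP[tH tL]]] := sweep gI dLH m_gt0 m_gt0.
  exists (above g L t), (below g H t); split; last by right; exact: before_threshold.
  split=> //.
  - exact: subset_trans (above_sub _ _ _) LS.
  - exact: subset_trans (below_sub _ _ _) HS.
  - by apply: before_sub bf; [exact: above_sub|exact: below_sub].
exists (below g L t), (above g H t); split; last by left; exact: before_threshold.
have := below_above g L t; have := below_above g H t => cH' cL'; split; try lia.
- exact: subset_trans (below_sub _ _ _) LS.
- exact: subset_trans (above_sub _ _ _) HS.
- by apply: before_sub bf; [exact: below_sub|exact: above_sub].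
Qed.

(** Cut [S] by [f] into consecutive parts of 5, 7 and 5 points.  If no decreasing
    pair shows up, then the first two parts become separated by [g] after two
    points are dropped from each, and so do the last two; the middle part loses
    two points on either side. *)
Lemma fat_pair_or_triple f g S : injective f -> injective g -> 17 <= #|S| ->
  (exists T1 T2, [/\ T1 \subset S, T2 \subset S, 3 <= #|T1|, 3 <= #|T2| & before f T1 T2] /\
     before g T2 T1) \/
  (exists T1 T2 T3, [/\ T1 \subset S, T2 \subset S & T3 \subset S] /\
    [/\ 3 <= #|T1|, 3 <= #|T2| & 3 <= #|T3|] /\
    [/\ before f T1 T2, before f T2 T3, before g T1 T2 & before g T2 T3]).
Proof.
move=> fI gI cS.
have [|s1 cA] := below_exact (n := 5) fI (S := S); first by lia.
set A := below f S s1 in cA; set R := above f S s1.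
have cR : 12 <= #|R| by have := below_above f S s1; rewrite -/A -/R; lia.
have [|s2 cB] := below_exact (n := 7) fI (S := R); first by lia.
set B := below f R s2 in cB; set C := above f R s2.
have cC : 5 <= #|C| by have := below_above f R s2; rewrite -/B -/C; lia.
have dAR : [disjoint A & R] by exact: disjoint_below_above.
have dBC : [disjoint B & C] by exact: disjoint_below_above.
have BR : B \subset R by exact: below_sub.
have CR : C \subset R by exact: above_sub.
have AS : A \subset S by exact: below_sub.
have RS : R \subset S by exact: above_sub.
have bAR : before f A R by exact: before_threshold.
have bBC : before f B C by exact: before_threshold.
have bAB : before f A B by exact: before_sub bAR.
have [t1 /orP[/andP[h1 h2]|/andP[h1 h2]]] :=
    sweep (m1 := 3) (m2 := 3) gI (disjointWr BR dAR) isT isT.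
  left; exists (above g A t1), (below g B t1); split; last exact: before_threshold.
  split=> //.
  - exact: subset_trans (above_sub _ _ _) AS.
  - exact: subset_trans (below_sub _ _ _) (subset_trans BR RS).
  - by apply: before_sub bAB; [exact: above_sub|exact: below_sub].
set B' := above g B t1.
have B'B : B' \subset B by exact: above_sub.
have cA' : 3 <= #|below g A t1| by have := below_above g A t1; lia.
have cB' : 5 <= #|B'| by have := below_above g B t1; rewrite -/B'; lia.
have [t2 /orP[/andP[k1 k2]|/andP[k1 k2]]] :=
    sweep (m1 := 3) (m2 := 3) gI (disjointWl B'B dBC) isT isT.
  left; exists (above g B' t2), (below g C t2); split; last exact: before_threshold.
  split=> //.
  - exact: subset_trans (above_sub _ _ _) (subset_trans B'B (subset_trans BR RS)).
  - exact: subset_trans (below_sub _ _ _) (subset_trans CR RS).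
  - by apply: before_sub bBC; [exact: subset_trans (above_sub _ _ _) B'B|exact: below_sub].
right; exists (below g A t1), (below g B' t2), (above g C t2); split; [split|split; split] => //.
- exact: subset_trans (below_sub _ _ _) AS.
- exact: subset_trans (below_sub _ _ _) (subset_trans B'B (subset_trans BR RS)).
- exact: subset_trans (above_sub _ _ _) (subset_trans CR RS).
- by have := below_above g B' t2; lia.
- by have := below_above g C t2; lia.
- by apply: before_sub bAB; [exact: below_sub|exact: subset_trans (below_sub _ _ _) B'B].
- by apply: before_sub bBC; [exact: subset_trans (below_sub _ _ _) B'B|exact: above_sub].
- have bg : before g (below g A t1) B' by exact: before_threshold.
  by apply: before_sub bg; rewrite ?subxx // below_sub.
- exact: before_threshold.
Qed.

(** Apply the preceding lemma to the reflection of [f]. *)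
Lemma fat_pair_or_triple_rev f g S : injective f -> injective g -> 17 <= #|S| ->
  (exists T1 T2, [/\ T1 \subset S, T2 \subset S, 3 <= #|T1|, 3 <= #|T2| & before f T1 T2] /\
     before g T1 T2) \/
  (exists T1 T2 T3, [/\ T1 \subset S, T2 \subset S & T3 \subset S] /\
    [/\ 3 <= #|T1|, 3 <= #|T2| & 3 <= #|T3|] /\
    [/\ before f T1 T2, before f T2 T3, before g T2 T1 & before g T3 T2]).
Proof.
move=> fI gI cS; pose K := \max_i f i; pose f' i := K - f i.
have fK i : f i <= K by exact: (leq_bigmax_cond (F := f)).
have rev T T' : before f' T T' -> before f T' T.
  by move=> h i j iT jT; have := h j i jT iT; rewrite /f'; have := fK i; have := fK j; lia.
have f'I : injective f' by move=> i j eqf; apply: fI; move: eqf (fK i) (fK j); rewrite /f'; lia.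
have [[T1 [T2 [[s1 s2 c1 c2 /rev h] hg]]]|] := fat_pair_or_triple f'I gI cS.
  by left; exists T2, T1.
case=> T1 [T2 [T3 [[s1 s2 s3] [[c1 c2 c3] [/rev h1 /rev h2 g1 g2]]]]].
by right; exists T3, T2, T1.
Qed.

(** The three orders allowed for [g] are, up to rotation and reversal, the order
    for [f].  A monotone triple in [Q] together with [P] makes up four blocks.
    Without such triples [Q] contains both an increasing and a decreasing pair,
    and the pair found in [P] is combined with the one of the same kind. *)
Lemma four_blocks f g (P Q : {set I}) : injective f -> injective g ->
    10 <= #|P| -> 17 <= #|Q| -> before f P Q -> before g P Q ->
  exists S1 S2 S3 S4,
    [/\ 3 <= #|S1|, 3 <= #|S2|, 3 <= #|S3| & 3 <= #|S4|] /\
    [/\ before f S1 S2, before f S2 S3 & before f S3 S4] /\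
    [\/ [/\ before g S1 S2, before g S2 S3 & before g S3 S4],
        [/\ before g S1 S4, before g S4 S3 & before g S3 S2]
      | [/\ before g S2 S1, before g S1 S4 & before g S4 S3]].
Proof.
move=> fI gI cP cQ fPQ gPQ.
have b3 h S T : S \subset P -> T \subset Q -> before h P Q -> before h S T.
  by move=> SP TQ; exact: before_sub.
have cP3 : 3 <= #|P| by lia.
have := fat_pair_or_triple_rev fI gI cQ.
case=> [[T1 [T2 [[s1 s2 c1 c2 h] hg]]]|]; last first.
  case=> T1 [T2 [T3 [[s1 s2 s3] [[c1 c2 c3] [h1 h2 g1 g2]]]]].
  exists P, T1, T2, T3; split=> //; split; first by split=> //; exact: b3.
  by apply: Or32; split=> //; exact: b3.
have := fat_pair_or_triple fI gI cQ.
case=> [[T1' [T2' [[s1' s2' c1' c2' h'] hg']]]|]; last first.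
  case=> U1 [U2 [U3 [[t1 t2 t3] [[d1 d2 d3] [h1 h2 g1 g2]]]]].
  exists P, U1, U2, U3; split=> //; split; first by split=> //; exact: b3.
  by apply: Or31; split=> //; exact: b3.
have [U1 [U2 [[t1 t2 d1 d2 hU] hgU]]] := fat_pair (m := 3) fI gI isT cP.
case: hgU => hgU.
  exists U1, U2, T1, T2; split=> //; split; first by split=> //; exact: b3.
  by apply: Or31; split=> //; exact: b3.
exists U1, U2, T1', T2'; split=> //; split; first by split=> //; exact: b3.
by apply: Or33; split=> //; exact: b3.
Qed.

End Points.


(** * Paths and cycles as vertex sets *)

Section PathSets.
Variable G : sgraph.
Implicit Types (S T : {set G}) (x y z u v : G) (p q s : seq G).

Definition path_set x y S := exists p,
  [/\ path (@edge G) x p, last x p = y, uniq (x :: p) & S = [set z in x :: p]].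

Definition cycle_set S := exists2 c, ucycle (@edge G) c & S = [set z in c].

Lemma path_set_sym x y S : path_set x y S -> path_set y x S.
Proof.
case=> p [ep lp up ->]; exists (rev (belast x p)).
have rp : y :: rev (belast x p) = rev (x :: p) by rewrite (lastI x p) rev_rcons lp.
split.
- rewrite -lp rev_path; rewrite (eq_path (e' := @edge G)) // => u v.
  exact: edge_sym.
- by move: rp; case: p {ep up lp} => [|z p] /=; rewrite ?rev_cons ?last_rcons // => -[].
- by rewrite rp rev_uniq.
- by apply/setP=> z; rewrite !inE -[RHS]/(z \in y :: _) rp mem_rev.
Qed.

Lemma path_set_ends x y S : path_set x y S -> x \in S /\ y \in S.
Proof. by case=> p [_ <- _ ->]; split; rewrite in_set ?mem_last ?mem_head. Qed.

Lemma path_set_cat x y z S T :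
    path_set x y S -> path_set y z T -> S :&: T \subset [set y] ->
  path_set x z (S :|: T).
Proof.
case=> p [ep lp up ->] [q [eq lq uq ->]] /subsetP ST; exists (p ++ q); split.
- by rewrite cat_path ep lp.
- by rewrite last_cat lp.
- rewrite -cat_cons cat_uniq up /=; move: uq => /= /andP[yq ->]; rewrite andbT.
  apply/hasPn=> w wq; apply/negP=> wp; case/negP: yq.
  have /set1P <- // : w \in [set y].
  by apply: ST; rewrite !inE wq orbT andbT.
apply/setP=> w; rewrite !inE mem_cat; case: (eqVneq w y) => [->|_]; last by rewrite orFb -orbA.
by have := mem_last x p; rewrite lp inE; case: (y == x) => //= ->.
Qed.

(** Cycles of length two, which run along an edge and back, are not excluded:
    the cycles used later have many vertices anyway. *)
Lemma cycle_set_of_paths x y S T :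
    path_set x y S -> path_set y x T -> x != y -> S :&: T \subset [set x; y] ->
  cycle_set (S :|: T).
Proof.
case=> p [ep lp up ->] [q [eq lq uq ->]] xy /subsetP ST.
case/lastP: q => [|q w] in eq lq uq ST *; first by rewrite -lq eqxx in xy.
rewrite last_rcons in lq; subst w.
exists (x :: p ++ q); last first.
  apply/setP=> w; rewrite !inE mem_cat mem_rcons inE.
  case: (eqVneq w x) => //= _; case: (eqVneq w y) => [->|_] //=.
  by have := mem_last x p; rewrite lp inE eq_sym (negPf xy) /= => ->.
apply/andP; split; first by rewrite /= rcons_cat cat_path ep lp.
rewrite -cat_cons cat_uniq up /=; move: uq => /= /andP[yq].
rewrite rcons_uniq => /andP[xq ->]; rewrite andbT.
apply/hasPn=> w wq; apply/negP=> wp.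
have /ST : w \in [set z in x :: p] :&: [set z in y :: rcons q x].
  by rewrite inE !in_set wp inE mem_rcons inE wq !orbT.
by case/set2P=> wE; [rewrite -wE wq in xq | rewrite -wE mem_rcons inE wq orbT in yq].
Qed.

(** The vertices of the list [s] that lie between [u] and [v], in whichever order
    the two occur. *)
Definition segment s u v :=
  [set z in s | minn (index u s) (index v s) <= index z s <= maxn (index u s) (index v s)].

Lemma segmentC s u v : segment s u v = segment s v u.
Proof. by rewrite /segment minnC maxnC. Qed.

Lemma segment_path s u v :
  sorted (@edge G) s -> uniq s -> u \in s -> v \in s -> path_set u v (segment s u v).
Proof.
wlog le_uv : u v / index u s <= index v s => [hw es us uin vin|].
  have [le|/ltnW le] := leqP (index u s) (index v s); first exact: hw.
  by rewrite segmentC; apply: path_set_sym; exact: hw.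
move=> es us uin vin; rewrite /segment (minn_idPl le_uv) (maxn_idPr le_uv).
have [s1 [s2 def_s]] : exists s1 s2, s = s1 ++ u :: s2.
  by case/splitPr: uin => s1 s2; exists s1, s2.
have us1 : u \notin s1.
  by move: us; rewrite def_s cat_uniq /= => /and3P[_ /norP[]].
have iu : index u s = size s1 by rewrite def_s index_pivot.
have vin2 : v \in u :: s2.
  move: vin; rewrite {1}def_s mem_cat => /orP[vs1|//]; move: le_uv.
  by rewrite iu leqNgt def_s index_cat vs1 index_mem vs1.
have [q [r [def2 lq]]] : exists q r, s2 = q ++ r /\ last u q = v.
  by case/splitPl: vin2 => q r lq; exists q, r.
have def_s' : s = (s1 ++ u :: q) ++ r by rewrite -catA def_s def2.
have iv : index v s = size s1 + size q.
  have -> : v = nth u s (size s1 + size q).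
    rewrite def_s' nth_cat size_cat /= addnS ltnS leqnn nth_cat ltnNge leq_addr /=.
    by rewrite addKn -lq -[last u q]/(last u (u :: q)) -nth_last.
  by rewrite index_uniq // def_s' !size_cat /=; lia.
have ep : path (@edge G) u q.
  move: es; rewrite def_s'; case: (s1) => [|w t] /=; rewrite !cat_path /=.
    by case/andP.
  by case/andP=> /and3P[].
have ups : uniq (s1 ++ u :: q) by move: us; rewrite def_s' cat_uniq => /and3P[].
exists q; split=> //; first by move: ups; rewrite cat_uniq => /and3P[].
apply/setP=> z; rewrite !in_set.
have [zs|zs] /= := boolP (z \in s); last first.
  by apply/esym/negbTE; apply: contra zs => zq; rewrite def_s' !mem_cat zq orbT.
rewrite leqNgt -in_take // -[index z s <= _]ltnS -in_take // iu iv -addnS.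
have -> : take (size s1) s = s1 by rewrite def_s take_size_cat.
have -> : take (size s1 + (size q).+1) s = s1 ++ u :: q.
  by rewrite def_s' take_size_cat // size_cat.
rewrite mem_cat; have [z1|z1] //= := boolP (z \in s1).
move: ups; rewrite cat_uniq => /and3P[_ /hasPn hn _].
by apply/esym/negbTE/negP=> /hn; rewrite /= z1.
Qed.

End PathSets.


(** * The order of a bramble *)

Section Order.
Variable G : sgraph.
Implicit Types (B : {set {set G}}) (S U W X Y : {set G}) (x y z : G) (p q c : seq G).

Definition bramble_order B := #|[arg min_(X < [set: G] | covers X B) #|X|]|.

Definition hit B X := [set U in B | ~~ [disjoint X & U]].
Definition miss B X := [set U in B | [disjoint X & U]].

Lemma covers_sub X Y B B' : X \subset Y -> B' \subset B -> covers X B -> covers Y B'.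
Proof.
move=> /subsetP XY /subsetP BB /coversP cX; apply/coversP=> U /BB/cX[x xX xU].
by exists x; first exact: XY.
Qed.

Lemma order_le B X : covers X B -> bramble_order B <= #|X|.
Proof.
move=> cX; rewrite /bramble_order; case: arg_minnP => [|Y _]; last exact.
exact: covers_sub (subsetT X) (subxx B) cX.
Qed.

Lemma order_ex B : set0 \notin B -> exists2 X, covers X B & #|X| = bramble_order B.
Proof.
move=> B0; rewrite /bramble_order; case: arg_minnP => [|X cX _]; last by exists X.
apply/coversP=> U UB; have /set0Pn[x xU] : U != set0 by apply: contraNneq B0 => <-.
by exists x.
Qed.

Lemma order_sub B B' : set0 \notin B' -> B \subset B' -> bramble_order B <= bramble_order B'.
Proof.
move=> B0 BB'; have [X cX <-] := order_ex B0; apply: order_le.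
exact: covers_sub (subxx X) BB' cX.
Qed.

Lemma orderU B B' : set0 \notin B -> set0 \notin B' -> bramble_order (B :|: B') <= bramble_order B + bramble_order B'.
Proof.
move=> B0 B0'; have [X cX <-] := order_ex B0; have [Y cY <-] := order_ex B0'.
apply: leq_trans (leq_card_setU _ _).1; apply: order_le; apply/coversP=> U.
rewrite inE => /orP[/(coversP cX)|/(coversP cY)] [x xX xU]; exists x => //.
  by rewrite inE xX.
by rewrite inE xX orbT.
Qed.

Lemma order_hit_card B X : bramble_order (hit B X) <= #|X|.
Proof. by apply: order_le; apply/forall_inP=> U; rewrite inE => /andP[]. Qed.

Lemma hit_sub B X : hit B X \subset B.
Proof. by apply/subsetP=> U; rewrite inE => /andP[]. Qed.

Lemma miss_sub B X : miss B X \subset B.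
Proof. by apply/subsetP=> U; rewrite inE => /andP[]. Qed.

Lemma hit0 B X : set0 \notin B -> set0 \notin hit B X.
Proof. by apply: contra => /(subsetP (hit_sub _ _)). Qed.

Lemma miss0 B X : set0 \notin B -> set0 \notin miss B X.
Proof. by apply: contra => /(subsetP (miss_sub _ _)). Qed.

Lemma in_hit B X U x : U \in B -> x \in X -> x \in U -> U \in hit B X.
Proof. by move=> UB xX xU; rewrite inE UB; apply/pred0Pn; exists x; rewrite /= xX. Qed.

Lemma hitP B X U : U \in hit B X -> U \in B /\ exists2 x, x \in X & x \in U.
Proof. by rewrite inE => /andP[UB /pred0Pn[x /andP[xX xU]]]; split=> //; exists x. Qed.

Lemma hit_mono B X Y : X \subset Y -> hit B X \subset hit B Y.
Proof. by move=> /subsetP XY; apply/subsetP=> U /hitP[UB [x /XY xY xU]]; exact: in_hit xU. Qed.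

Lemma hitU B X Y : hit B (X :|: Y) = hit B X :|: hit B Y.
Proof.
apply/eqP; rewrite eqEsubset subUset !hit_mono ?subsetUl ?subsetUr // !andbT.
apply/subsetP=> U /hitP[UB [x]]; rewrite !in_setU => /orP[] xX xU.
  by rewrite (in_hit UB xX xU).
by rewrite (in_hit UB xX xU) orbT.
Qed.

Lemma hit_miss B X : B = hit B X :|: miss B X.
Proof. by apply/setP=> U; rewrite !inE -andb_orr orNb andbT. Qed.

Lemma order_hit_miss B X : set0 \notin B -> bramble_order B <= bramble_order (hit B X) + bramble_order (miss B X).
Proof.
move=> B0; rewrite {1}(hit_miss B X); by apply: orderU; [exact: hit0|exact: miss0].
Qed.

(** Adding a vertex increases the order of the subfamily that is met by at most
    one. *)
Lemma order_prefix B c n : set0 \notin B -> 0 < n -> n <= bramble_order (hit B [set z in c]) ->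
  exists c0 z c1, [/\ c = rcons c0 z ++ c1, bramble_order (hit B [set w in rcons c0 z]) = n
    & bramble_order (hit B [set w in c0]) < n].
Proof.
move=> B0 n0 le_n; pose f i := bramble_order (hit B [set z in take i c]).
have ex : exists i, n <= f i by exists (size c); rewrite /f take_size.
case: (ex_minnP ex) => -[|i] le_i mini.
  have := order_hit_card B [set z in take 0 c]; rewrite -/(f 0) take0.
  have -> : [set z in [::]] = set0 :> {set G} by apply/setP=> z; rewrite !inE.
  by rewrite cards0; lia.
have lt_i : f i < n by rewrite ltnNge; apply/negP=> /mini; rewrite ltnn.
have ic : i < size c.
  rewrite ltnNge; apply/negP=> ci; move: le_i lt_i.
  by rewrite /f !take_oversize ?(leq_trans ci) // leqNgt => /negP.
case: c => [//|x0 c'] in f ex mini le_i lt_i le_n ic *; set c := x0 :: c' in f ex mini le_i lt_i le_n ic *.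
exists (take i c), (nth x0 c i), (drop i.+1 c).
rewrite -take_nth // cat_take_drop; split=> //; apply/eqP; rewrite eqn_leq le_i andbT.
have -> : [set w in take i.+1 c] = [set w in take i c] :|: [set nth x0 c i].
  by apply/setP=> w; rewrite (take_nth x0) // !inE mem_rcons inE orbC.
rewrite hitU; apply: leq_trans (orderU _ _) _; try exact: hit0.
have := order_hit_card B [set nth x0 c i]; rewrite cards1.
by move: lt_i; rewrite /f; lia.
Qed.

Lemma bramble_nonempty B : bramble B -> set0 \notin B.
Proof. by case=> cB _; apply/negP=> /cB[]; rewrite eqxx. Qed.

Lemma bramble_sub B B' : bramble B -> B' \subset B -> bramble B'.
Proof.
move=> [cB tB] /subsetP BB; split=> [U /BB/cB //|U W /BB UB /BB WB]; exact: tB.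
Qed.

(** A set [S] of fewer than [k] vertices misses an element meeting [X] and an
    element meeting [Y]; the union of the two is connected and avoids [S]. *)
Lemma bramble_linked B X Y k : bramble B ->
  k <= bramble_order (hit B X) -> k <= bramble_order (hit B Y) -> linked (inside (cover B)) X Y k.
Proof.
move=> [cB tB] kX kY; apply: menger => S sepS; rewrite leqNgt; apply/negP=> ltS.
have out Z : k <= bramble_order (hit B Z) ->
    exists U z, [/\ U \in B, z \in Z, z \in U & [disjoint S & U]].
  move=> kZ; have /coversPn[U /hitP[UB [z zZ zU]] dU] : ~~ covers S (hit B Z).
    by apply/negP=> /order_le; lia.
  by exists U, z.
have [U [x [UB xX xU dU]]] := out X kX; have [W [y [WB yY yW dW]]] := out Y kY.
have cUW := connectedU (cB U UB) (cB W WB) (tB U W UB WB).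
have [||p [ep lp sp]] := connected_walk cUW (x := x) (y := y).
- by rewrite inE xU.
- by rewrite inE yW orbT.
have [||z /sp + zS] := sepS x p xX; last 1 first.
- by rewrite inE (negPf (disjointP dU z zS)) (negPf (disjointP dW z zS)).
- apply: walk_inside ep _ => z /sp; rewrite inE => /orP[zU|zW]; apply/bigcupP.
    by exists U.
  by exists W.
by rewrite lp.
Qed.

Lemma connected_path_set S x y : connected_set S -> x \in S -> y \in S ->
  exists2 P, path_set x y P & P \subset S.
Proof.
move=> cS xS yS; have [p [ep lp sp]] := connected_walk cS xS yS.
case/shortenP: ep lp => p' ep' up' sp' lp.
exists [set z in x :: p']; first by exists p'.
by apply/subsetP=> z; rewrite in_set inE => /predU1P[->//|/sp' zp]; apply: sp; rewrite inE zp orbT.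
Qed.

Definition covering_path B x p :=
  [/\ path (@edge G) x p, uniq (x :: p), {subset x :: p <= cover B}
    & covers [set z in x :: p] B].

(** Extend a path that meets some element [U] of the bramble in its last vertex
    only: if it misses the element [W], walk on inside [U :|: W] until [W] is
    reached for the first time. *)
Lemma bramble_path B : bramble B -> B != set0 -> exists x p, covering_path B x p.
Proof.
move=> [cB tB] /set0Pn[U0 U0B]; have [/set0Pn[x0 x0U] _] := cB U0 U0B.
suff main n x p U : #|miss B [set z in x :: p]| < n -> path (@edge G) x p ->
    uniq (x :: p) -> {subset x :: p <= cover B} -> U \in B -> last x p \in U ->
    {in belast x p, forall z, z \notin U} -> exists x p, covering_path B x p.
  apply: (main _ x0 [::] U0 (ltnSn _)) => // z; rewrite inE => /eqP->.
  by apply/bigcupP; exists U0.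
elim: n x p U => // n IH x p U; rewrite ltnS => le_n ep up sp UB lU outU.
have [cov|/coversPn[W WB dW]] := boolP (covers [set z in x :: p] B); first by exists x, p.
have [/set0Pn[w wW] _] := cB W WB.
have cUW := connectedU (cB U UB) (cB W WB) (tB U W UB WB).
have [||_ [q0 [eq0 lq0 uq0 ->]] /subsetP sq0] := connected_path_set cUW (x := last x p) (y := w).
- by rewrite inE lU.
- by rewrite inE wW orbT.
have [|q [r [def_q0 lqW outW]]] := first_hit (mem_last (last x p) q0) (S := W).
  by rewrite lq0.
have eq : path (@edge G) (last x p) q by move: eq0; rewrite def_q0 cat_path => /andP[].
have uq : uniq (last x p :: q) by move: uq0; rewrite def_q0 -cat_cons cat_uniq => /and3P[].
have sq z : z \in q -> z \in U \/ z \in W.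
  move=> zq; have : z \in U :|: W.
    by apply: sq0; rewrite in_set def_q0 inE mem_cat zq orbT.
  by rewrite inE => /orP.
have pW z : z \in x :: p -> z \notin W by move=> zp; apply: (disjointP dW); rewrite in_set.
have npq z : z \in q -> z \notin x :: p.
  move=> zq; apply/negP=> zp; case: (sq z zq) => [zU|]; last exact/negP/pW.
  move: zp; rewrite lastI mem_rcons inE => /predU1P[zl|/outU]; last by rewrite zU.
  by move: uq; rewrite /= -zl zq.
apply: (IH x (p ++ q) W) => //.
- apply: leq_trans le_n; apply: proper_card; apply/properP; split.
    apply/subsetP=> V; rewrite !inE => /andP[-> /disjointP h]; apply/disjointP=> z.
    by rewrite in_set => zp; apply: h; rewrite in_set -cat_cons mem_cat zp.
  exists W; rewrite !inE WB //=; apply/negP=> /disjointP/(_ (last (last x p) q)).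
  rewrite in_set -last_cat mem_last => /(_ isT); rewrite last_cat; exact/negP/negPn.
- by rewrite cat_path ep.
- rewrite -cat_cons cat_uniq up /=; move: uq => /= /andP[_ ->]; rewrite andbT.
  by apply/hasPn=> z /npq.
- move=> z; rewrite -cat_cons mem_cat => /orP[/sp //|/sq[] zU]; apply/bigcupP.
    by exists U.
  by exists W.
- by rewrite last_cat.
move=> z; rewrite belast_cat mem_cat => /orP[/mem_belast/pW //|]; exact: outW.
Qed.

(** On a shortest path that meets all elements, each end is the only vertex met by
    some element.  The union of these two elements is connected, and in it the
    ends are joined by a path that avoids the rest of the first path. *)
Lemma bramble_cycle B : bramble B -> 1 < bramble_order B ->
  exists C, [/\ cycle_set C, covers C B & C \subset cover B].
Proof.
move=> bB ord2; have [cB tB] := bB.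
have B0 : B != set0.
  apply: contraTneq ord2 => ->; rewrite -leqNgt; apply: leq_trans (order_le (X := set0) _) _.
    by apply/coversP=> U; rewrite inE.
  by rewrite cards0.
have [x [p]] := bramble_path bB B0.
have [n] := ubnP (size p); elim: n x p => // n IH x p; rewrite ltnS => le_n [ep up sp cov].
case/lastP: p => [|p y] in ep up sp cov le_n *.
  have := order_le cov; rewrite leqNgt.
  have -> : [set z in [:: x]] = [set x] by apply/setP=> z; rewrite !inE.
  by rewrite cards1 ord2.
move: ep; rewrite rcons_path => /andP[ep lpy].
have [cov1|/coversPn[U1 U1B dU1]] := boolP (covers [set z in x :: p] B).
  apply: (IH x p); first by rewrite size_rcons in le_n.
  split=> //; first by move: up; rewrite -rcons_cons rcons_uniq => /andP[].
  by move=> z zp; apply: sp; rewrite -rcons_cons mem_rcons inE zp orbT.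
have [z [q def_p]] : exists z q, rcons p y = z :: q.
  by case: (p) => [|a b]; [exists y, [::] | exists a, (rcons b y)].
have [ezq xz] : path (@edge G) z q /\ edge x z.
  have : path (@edge G) x (rcons p y) by rewrite rcons_path ep.
  by rewrite def_p /= => /andP[].
have [cov2|/coversPn[U2 U2B dU2]] := boolP (covers [set w in rcons p y] B).
  apply: (IH z q); first by rewrite def_p in le_n.
  split=> //; rewrite -?def_p //; first by move: up => /= /andP[].
  by move=> w wp; apply: sp; rewrite inE wp orbT.
have hitP1 U : U \in B -> [disjoint [set w in x :: p] & U] -> y \in U.
  move=> UB /disjointP dU; have [w] := coversP cov U UB.
  rewrite in_set -rcons_cons mem_rcons inE => /predU1P[-> //|wp wU].
  by have := dU w; rewrite in_set wp wU => /(_ isT).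
have hitP2 U : U \in B -> [disjoint [set w in rcons p y] & U] -> x \in U.
  move=> UB /disjointP dU; have [w] := coversP cov U UB.
  rewrite in_set inE => /predU1P[-> //|wp wU].
  by have := dU w; rewrite in_set wp wU => /(_ isT).
have yU1 := hitP1 U1 U1B dU1; have xU2 := hitP2 U2 U2B dU2.
have cU := connectedU (cB _ U1B) (cB _ U2B) (tB _ _ U1B U2B).
have [||R pR /subsetP sR] := connected_path_set cU (x := y) (y := x).
- by rewrite inE yU1.
- by rewrite inE xU2 orbT.
exists ([set w in x :: rcons p y] :|: R); split.
- apply: (cycle_set_of_paths _ pR).
  + by exists (rcons p y); split; rewrite ?rcons_path ?ep ?last_rcons.
  + by apply: contraTneq up => ->; rewrite /= mem_rcons mem_head.
  apply/subsetP=> w; rewrite inE in_set => /andP[wp /sR].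
  rewrite !inE => /orP[wU|wU].
    move: wp; rewrite -rcons_cons mem_rcons inE => /predU1P[->|wp]; first by rewrite eqxx orbT.
    by have := disjointP dU1 w; rewrite in_set wp wU => /(_ isT).
  move: wp; rewrite inE => /predU1P[->|wp]; first by rewrite eqxx.
  by have := disjointP dU2 w; rewrite in_set wp wU => /(_ isT).
- exact: covers_sub (subsetUl _ _) (subxx _) cov.
apply/subsetP=> w; rewrite inE in_set => /orP[/sp //|/sR].
by rewrite inE => /orP[] wU; apply/bigcupP; [exists U1 | exists U2].
Qed.

End Order.


(** * Two disjoint cycles of large order *)

(** Start each path at its last vertex in [A] and stop at the first vertex in [B]
    thereafter. *)
Lemma linked_trim (V : finType) (e : rel V) (A B : {set V}) k : linked e A B k ->
  exists (a : 'I_k -> V) (p : 'I_k -> seq V), [/\ linkage e A B a p,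
    forall i, {in p i, forall z, z \notin A}
  & forall i, {in belast (a i) (p i), forall z, z \notin B}].
Proof.
case=> a0 [p0 [aA pB ep up disj]].
have [f fP] : exists f : 'I_k -> V * seq V, forall i, let: (a, p) := f i in
    [/\ a \in A, last a p \in B, path e a p, uniq (a :: p) & {subset a :: p <= a0 i :: p0 i}] /\
    {in p, forall z, z \notin A} /\ {in belast a p, forall z, z \notin B}.
  apply: (@fin_all_exists _ (fun=> (V * seq V)%type) (fun i f => let: (a, p) := f in
    [/\ a \in A, last a p \in B, path e a p, uniq (a :: p) & {subset a :: p <= a0 i :: p0 i}] /\
    {in p, forall z, z \notin A} /\ {in belast a p, forall z, z \notin B})) => i.
  have [q [z [r [def_p zA rA]]]] := last_hit (mem_head (a0 i) (p0 i)) (aA i).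
  have [er lr] := path_suffix def_p (ep i).
  have [|q' [r' [def_r lq' q'B]]] := first_hit (mem_last z r) (S := B).
    by rewrite lr.
  exists (z, q'); split; last split=> //.
    split=> //; first by move: er; rewrite def_r cat_path => /andP[].
      by move: (up i); rewrite def_p def_r cat_uniq -cat_cons cat_uniq => /and3P[_ _ /andP[]].
    by move=> w wq; rewrite def_p def_r -cat_cons !mem_cat wq orbT.
  by move=> w wq; apply: rA; rewrite def_r mem_cat wq.
exists (fun i => (f i).1), (fun i => (f i).2).
split; [split|..] => [i|i|i|i|i j z|i|i]; try by have := fP i; case: (f i) => a p [[]] //= ? ? ? ? ? [].
have := fP i; have := fP j; case: (f i) => a p; case: (f j) => b q /=.
case=> [[_ _ _ _ sj] _] [[_ _ _ _ si] _] /si zi /sj zj; exact: disj zi zj.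
Qed.

Section DisjointCycles.
Variable G : sgraph.
Implicit Types (B : {set {set G}}) (P C Z : {set G}) (a b x y z : G) (X Y s : seq G).

Lemma segmentP s u v z : z \in segment s u v ->
  z \in s /\ minn (index u s) (index v s) <= index z s <= maxn (index u s) (index v s).
Proof. by rewrite in_set => /andP. Qed.

Lemma segment_ends s u v : u \in s -> v \in s -> u \in segment s u v /\ v \in segment s u v.
Proof. by move=> us vs; rewrite !in_set us vs geq_minl geq_minr leq_maxl leq_maxr. Qed.

Definition rung_cycle X Y a1 b1 P1 a2 b2 P2 :=
  segment Y a1 a2 :|: P1 :|: segment X b1 b2 :|: P2.

Lemma rung_cycleP X Y a1 b1 P1 a2 b2 P2 :
    sorted (@edge G) X -> uniq X -> sorted (@edge G) Y -> uniq Y -> {in X, forall z, z \notin Y} ->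
    path_set a1 b1 P1 -> path_set a2 b2 P2 -> [disjoint P1 & P2] ->
    a1 \in Y -> a2 \in Y -> b1 \in X -> b2 \in X ->
    {in P1, forall z, (z \in Y -> z = a1) /\ (z \in X -> z = b1)} ->
    {in P2, forall z, (z \in Y -> z = a2) /\ (z \in X -> z = b2)} ->
  [/\ cycle_set (rung_cycle X Y a1 b1 P1 a2 b2 P2),
      {in rung_cycle X Y a1 b1 P1 a2 b2 P2, forall z, z \in Y -> z \in segment Y a1 a2},
      {in rung_cycle X Y a1 b1 P1 a2 b2 P2, forall z, z \in X -> z \in segment X b1 b2}
    & {in rung_cycle X Y a1 b1 P1 a2 b2 P2, forall z, z \notin X -> z \notin Y -> z \in P1 :|: P2}].
Proof.
move=> sX uX sY uY dXY pP1 pP2 dP a1Y a2Y b1X b2X h1 h2.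
have [a1S a2S] := segment_ends a1Y a2Y; have [b1S b2S] := segment_ends b1X b2X.
have SY z : z \in segment Y a1 a2 -> z \in Y by case/segmentP.
have SX z : z \in segment X b1 b2 -> z \in X by case/segmentP.
have [a1P b1P] := path_set_ends pP1; have [a2P b2P] := path_set_ends pP2.
have nb2 : a2 != b2 by apply: contraTneq a2Y => ->; exact: dXY.
split.
- apply: (@cycle_set_of_paths _ a2 b2) => //; last 1 first.
  + apply/subsetP=> z; rewrite in_set => /andP[zU zP2]; rewrite in_set2.
    move: zU; rewrite !in_setU -orbA => /or3P[/SY zY|zP1|/SX zX].
    * by rewrite (h2 z zP2).1 ?eqxx.
    * by have := disjointP dP z zP1; rewrite zP2.
    * by rewrite [z](h2 z zP2).2 ?eqxx ?orbT.
  + apply: (@path_set_cat _ _ b1); [apply: (@path_set_cat _ _ a1) => //|..].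
    * by rewrite segmentC; exact: segment_path.
    * by apply/subsetP=> z /setIP[/SY zY zP]; rewrite in_set1 (h1 z zP).1.
    * exact: segment_path.
    * apply/subsetP=> z /setIP[zU /SX zX]; rewrite in_set1.
      move: zU; rewrite in_setU => /orP[/SY|/h1[_ ->//]].
      by rewrite (negPf (dXY z zX)).
  + exact: path_set_sym.
- move=> z; rewrite !in_setU => zU zY; case/orP: zU => [/orP[/orP[//|zP1]|/SX zX]|zP2].
  + by rewrite (h1 z zP1).1.
  + by rewrite (negPf (dXY z zX)) in zY.
  + by rewrite (h2 z zP2).1.
- move=> z; rewrite !in_setU => zU zX; case/orP: zU => [/orP[/orP[/SY zY|zP1]|//]|zP2].
  + by have := dXY z zX; rewrite zY.
  + by rewrite (h1 z zP1).2.
  + by rewrite (h2 z zP2).2.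
move=> z; rewrite !in_setU => zU zX zY; case/orP: zU => [/orP[/orP[/SY|->//]|/SX]|->].
- by rewrite (negPf zY).
- by rewrite (negPf zX).
- by rewrite orbT.
Qed.

(** A segment reaches an end of the list only if it starts or stops there. *)
Lemma index_minmax s u v z : u \in s -> v \in s ->
  index z s = 0 \/ index z s = (size s).-1 -> z \in segment s u v -> z = u \/ z = v.
Proof.
move=> us vs h /segmentP[zs]; have ui := us; have vi := vs; have zi := zs.
rewrite -index_mem in ui; rewrite -index_mem in vi; rewrite -index_mem in zi.
have inj w : w \in s -> index z s = index w s -> z = w.
  by move=> ws eqi; rewrite -(nth_index z zs) eqi nth_index.
case/andP=> lo hi; have [eqi|eqi] : index z s = index u s \/ index z s = index v s.
  by move: h lo hi ui vi zi; move: (index u s) (index v s) (index z s) (size s) => i j k n; lia.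
  by left; exact: inj.
by right; exact: inj.
Qed.

Lemma segment_disjoint s u v u' v' z :
    index u s < index u' s -> index u s < index v' s ->
    index v s < index u' s -> index v s < index v' s ->
  z \in segment s u v -> z \notin segment s u' v'.
Proof.
move=> h1 h2 h3 h4 /segmentP[_ /andP[_ hi]]; apply/negP=> /segmentP[_ /andP[lo _]].
have := leq_trans lo hi; rewrite leqNgt => /negP; apply.
by rewrite leq_min !gtn_max h1 h2 h3 h4.
Qed.

(** In the proof, [M], [Y] and [X] are consecutive arcs, in the cyclic order
    [X], [M], [Y], of a cycle that meets all elements.  The orders of [X] and [Y]
    are taken with respect to the family [B'] of the elements that miss [M]. *)
Theorem disjoint_cycles B N : bramble B -> 1 < N -> 3 * N + 9 <= bramble_order B ->
  exists C1 C2, [/\ cycle_set C1, cycle_set C2, [disjoint C1 & C2],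
    N <= bramble_order (hit B C1) & N <= bramble_order (hit B C2)].
Proof.
move=> bB N1 ordB; have B0 := bramble_nonempty bB.
(* The elements missed by a cycle of intermediate order supply the other cycle. *)
have one C1 : cycle_set C1 -> N <= bramble_order (hit B C1) -> bramble_order (hit B C1) <= N.*2 + 9 ->
    exists C1 C2, [/\ cycle_set C1, cycle_set C2, [disjoint C1 & C2],
      N <= bramble_order (hit B C1) & N <= bramble_order (hit B C2)].
  move=> cC1 leN le2N; have ordm : N <= bramble_order (miss B C1).
    by have := order_hit_miss C1 B0; lia.
  have bm : bramble (miss B C1) := bramble_sub bB (miss_sub _ _).
  have [C2 [cC2 covC2 sC2]] := bramble_cycle bm (leq_trans N1 ordm).
  exists C1, C2; split=> //.
    apply/disjointP=> x x1; apply/negP=> /(subsetP sC2)/bigcupP[U].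
    by rewrite inE => /andP[_ /disjointP/(_ x x1)/negP].
  apply: leq_trans ordm _; apply: order_sub; first exact: hit0.
  apply/subsetP=> U UB; have [x xC xU] := coversP covC2 U UB.
  exact: in_hit (subsetP (miss_sub _ _) _ UB) xC xU.
have [|C [[c uc ->] cov _]] := bramble_cycle bB; first by lia.
have [|M0 [m [c1 [def_c ordM _]]]] := @order_prefix G B c N B0 (ltnW N1).
  apply: leq_trans (order_sub (hit0 _ B0) (_ : B \subset _)); first by lia.
  by apply/subsetP=> U UB; have [x xC xU] := coversP cov U UB; exact: in_hit xC xU.
set M := rcons M0 m in def_c ordM; set B' := miss B [set z in M].
have B'0 : set0 \notin B' by exact: miss0.
have bB' : bramble B' := bramble_sub bB (miss_sub _ _).
have ordB' : N.*2 + 9 <= bramble_order B' by have := order_hit_miss [set z in M] B0; rewrite ordM -/B'; lia.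
have hitc1 : B' \subset hit B' [set z in c1].
  apply/subsetP=> U UB'; have := UB'; rewrite inE => /andP[UB /disjointP dU].
  have [x xC xU] := coversP cov U UB; apply: (in_hit UB' _ xU); move: xC.
  rewrite !in_set def_c mem_cat => /orP[xM|//].
  by have := dU x; rewrite in_set xM xU => /(_ isT).
have [|Y0 [y [c2 [def_c1 ordY ordY0]]]] := @order_prefix G B' c1 6 B'0 isT.
  by apply: leq_trans (order_sub (hit0 _ B'0) hitc1); lia.
set Y := rcons Y0 y in def_c1 ordY.
have [|X0 [x [c3 [def_c2 ordX ordX0]]]] := @order_prefix G B' (rev c2) 6 B'0 isT.
  have -> : [set z in rev c2] = [set z in c2] by apply/setP=> z; rewrite !inE mem_rev.
  have := order_sub (hit0 _ B'0) hitc1.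
  have -> : [set z in c1] = [set z in Y] :|: [set z in c2].
    by apply/setP=> z; rewrite !inE def_c1 mem_cat.
  by rewrite hitU; have := orderU (hit0 [set z in Y] B'0) (hit0 [set z in c2] B'0); lia.
pose X := rev (rcons X0 x).
have {}def_c2 : c2 = rev c3 ++ X by rewrite -[c2]revK def_c2 rev_cat.
have setX : [set z in X] = [set z in rcons X0 x] by apply/setP=> z; rewrite !in_set mem_rev.
have ordX' : 6 <= bramble_order (hit B' [set z in X]) by rewrite setX ordX.
have ordY' : 6 <= bramble_order (hit B' [set z in Y]) by rewrite ordY.
(* Rotating the cycle makes the three arcs a path. *)
pose L := X ++ M ++ Y.
have [sL uL] : sorted (@edge G) L /\ uniq L.
  have : ucycle (@edge G) (rot (size (M ++ Y ++ rev c3)) c) by rewrite rot_ucycle.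
  have -> : rot (size (M ++ Y ++ rev c3)) c = L ++ rev c3.
    by rewrite def_c def_c1 def_c2 /L !catA rot_size_cat -!catA.
  rewrite /L /X rev_rcons => /andP[] /=; rewrite rcons_path cat_path => /andP[/andP[-> _] _].
  by rewrite cat_uniq mem_cat negb_or => /andP[/andP[-> _] /and3P[-> _ _]].
have [sX sMY] := cat_sorted2 sL; have [_ sY] := cat_sorted2 sMY.
have [uX dXMY uMY] : [/\ uniq X, {in X, forall z, z \notin M ++ Y} & uniq (M ++ Y)].
  move: uL; rewrite cat_uniq => /and3P[-> /hasPn h ->]; split=> // z zX.
  by apply/negP=> /h; rewrite /= zX.
have [dMY uY] : {in M, forall z, z \notin Y} /\ uniq Y.
  move: uMY; rewrite cat_uniq => /and3P[_ /hasPn h ->]; split=> // z zM.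
  by apply/negP=> /h; rewrite /= zM.
have dXY : {in X, forall z, z \notin Y}.
  by move=> z /dXMY; rewrite mem_cat negb_or => /andP[].
have [a [p [[aY bX ep up disj] trimY trimX]]] := linked_trim (bramble_linked bB' ordY' ordX').
pose b i := last (a i) (p i); pose P i := [set z in a i :: p i].
have {}aY i : a i \in Y by have := aY i; rewrite in_set.
have {}bX i : b i \in X by have := bX i; rewrite in_set.
have aP i : a i \in P i by rewrite in_set mem_head.
have bP i : b i \in P i by rewrite in_set mem_last.
have pP i : path_set (a i) (b i) (P i).
  by exists (p i); split=> //; case: (inside_walk (ep i)).
have hP i : {in P i, forall z, (z \in Y -> z = a i) /\ (z \in X -> z = b i)}.
  move=> z; rewrite in_set => zP; split=> [zY|zX].
    by move: zP; rewrite inE => /predU1P[//|/trimY]; rewrite in_set zY.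
  by move: zP; rewrite lastI mem_rcons inE => /predU1P[//|/trimX]; rewrite in_set zX.
have MP i z : z \in P i -> z \notin M.
  rewrite in_set inE => /predU1P[->|zp].
    by apply/negP=> /dMY; rewrite aY.
  have [_ /(_ z zp)/bigcupP[U]] := inside_walk (ep i).
  rewrite inE => /andP[_ /disjointP dU] zU; apply/negP=> zM.
  by have := dU z; rewrite in_set zM zU => /(_ isT).
have dP i j : i != j -> [disjoint P i & P j].
  move=> ij; apply/disjointP=> z; rewrite !in_set => zi; apply/negP=> zj.
  by rewrite (disj i j z zi zj) eqxx in ij.
have aI : injective a by move=> i j aij; apply: (disj i j (a i)); rewrite ?mem_head // aij mem_head.
have bI : injective b by move=> i j bij; apply: (disj i j (b i)); rewrite ?mem_last // -/(b i) bij mem_last.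
pose Z i j := rung_cycle X Y (a i) (b i) (P i) (a j) (b j) (P j).
have ZP i j : i != j -> _ := fun ij => rung_cycleP sX uX sY uY dXY (pP i) (pP j) (dP i j ij)
  (aY i) (aY j) (bX i) (bX j) (hP i) (hP j).
(* The cycle [C1] runs from [b i] through the part of [X] next to [M], along [M]
   and into [Y] up to [a i], and back along the path [P i].  It reaches the outer
   end of [X] or of [Y] only in a vertex of [P i], hence of [Z i j]; so outside
   [Z i j] it meets at most elements of order 5 of [B'] on either side. *)
have small i j : i != j -> bramble_order (hit B (Z i j)) < N ->
    exists C1 C2, [/\ cycle_set C1, cycle_set C2, [disjoint C1 & C2],
      N <= bramble_order (hit B C1) & N <= bramble_order (hit B C2)].
  move=> ij ordZ; pose C1 := segment L (b i) (a i) :|: P i.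
  have aL : a i \in L by rewrite !mem_cat aY !orbT.
  have bL : b i \in L by rewrite mem_cat bX.
  have idx z : z \in L -> index z L = if z \in X then index z X
      else size X + (if z \in M then index z M else size M + index z Y).
    by rewrite !index_cat.
  have aM : a i \notin M by exact: MP (aP i).
  have aX : a i \notin X by apply/negP=> /dXY; rewrite aY.
  have MC1 : [set z in M] \subset C1.
    apply/subsetP=> z; rewrite in_set => zM; rewrite in_setU in_set.
    have zX : z \notin X by apply/negP=> /dXMY; rewrite mem_cat zM.
    rewrite !mem_cat zM orbT (idx _ aL) (idx _ bL) bX (negPf aX) (negPf aM) /L !index_cat.
    rewrite (negPf zX) zM /=; apply/orP; left.
    have bi : index (b i) X <= size X by rewrite ltnW // index_mem.
    have zi : index z M <= size M by rewrite ltnW // index_mem.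
    rewrite geq_min leq_max (leq_trans bi (leq_addr _ _)) /= !leq_add2l.
    by rewrite (leq_trans zi (leq_addr _ _)) orbT.
  have cC1 : cycle_set C1.
    apply: cycle_set_of_paths (segment_path sL uL bL aL) (pP i) _ _.
      by apply: contraTneq (bX i) => ->.
    apply/subsetP=> z /setIP[/segmentP[zL _] zP]; rewrite in_set2.
    have zM := MP i z zP; move: zL; rewrite !mem_cat (negPf zM) => /orP[zX|zY].
      by rewrite [z](hP i z zP).2 ?eqxx.
    by rewrite [z](hP i z zP).1 ?eqxx ?orbT.
  apply: (one C1) => //; first by rewrite -ordM; apply: order_sub; [exact: hit0|exact: hit_mono].
  have PZ : P i \subset Z i j.
    by apply/subsetP=> z zP; rewrite /Z /rung_cycle !in_setU zP orbT.
  have sub : hit B C1 \subset (hit B [set z in M] :|: hit B (Z i j)) :|: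
      (hit B' [set z in X0] :|: hit B' [set z in Y0]).
    apply/subsetP=> U /hitP[UB [z zC zU]].
    have [UM|UM] := boolP (U \in hit B [set z in M]); first by rewrite !in_setU UM.
    have UB' : U \in B' by move: UM; rewrite !inE UB /= negbK.
    have [zP|zP] := boolP (z \in P i).
      by rewrite !in_setU (in_hit UB (subsetP PZ z zP) zU) !orbT.
    have zS : z \in segment L (b i) (a i).
      by case/setUP: zC => // zPi; rewrite zPi in zP.
    have [zL _] := segmentP zS.
    have zab : ~ (z = b i \/ z = a i) by case=> zE; rewrite zE ?aP ?bP in zP.
    have noend : ~ (index z L = 0 \/ index z L = (size L).-1).
      by move=> h; apply: zab; exact: index_minmax zS.
    move: zL; rewrite !mem_cat => /or3P[zX|zM|zY].
    - have zX0 : z \in [set z in X0].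
        move: zX; rewrite mem_rev mem_rcons in_set inE => /predU1P[zx|//]; case: noend; left.
        by rewrite zx /L /X rev_rcons /= eqxx.
      by rewrite !in_setU (in_hit UB' zX0 zU) !orbT.
    - by rewrite (in_hit UB _ zU) ?in_set in UM.
    have zY0 : z \in [set z in Y0].
      move: zY; rewrite mem_rcons in_set inE => /predU1P[zy|//]; case: noend; right.
      have yY : y \in Y by rewrite mem_rcons mem_head.
      have yL : y \in L by rewrite !mem_cat yY !orbT.
      have -> : z = nth y L (size L).-1.
        by rewrite nth_last !last_cat last_rcons.
      by rewrite index_uniq //; case: (L) yL.
    by rewrite !in_setU (in_hit UB' zY0 zU) !orbT.
  apply: leq_trans (order_sub _ sub) _.
    by rewrite !in_setU !negb_or !hit0.
  have h1 := orderU (hit0 [set z in M] B0) (hit0 (Z i j) B0).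
  have h2 := orderU (hit0 [set z in X0] B'0) (hit0 [set z in Y0] B'0).
  apply: leq_trans (orderU _ _) _; try by rewrite in_setU negb_or !hit0.
  apply: leq_trans (leq_add h1 h2) _; rewrite ordM; clear -ordZ ordX0 ordY0.
  by move: ordZ ordX0 ordY0; do 3 move: (bramble_order _) => ?; lia.
(* Two of the six paths are separated on both arcs from two others. *)
pose f i := index (a i) Y; pose g i := index (b i) X.
have fI : injective f by move=> i j eqf; apply: aI; rewrite -(nth_index y (aY i)) -/(f i) eqf nth_index.
have gI : injective g by move=> i j eqf; apply: bI; rewrite -(nth_index y (bX i)) -/(g i) eqf nth_index.
have [|T1 [T2 [[_ _ c1T c2T fT] gT]]] := fat_pair (S := [set: 'I_6]) (m := 2) fI gI isT.
  by rewrite cardsT card_ord.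
have /card_gt1P[i1 [i2 [i1T i2T i12]]] := c1T; have /card_gt1P[j1 [j2 [j1T j2T j12]]] := c2T.
have [ltN|leN] := ltnP (bramble_order (hit B (Z i1 i2))) N; first exact: small ltN.
have [ltN'|leN'] := ltnP (bramble_order (hit B (Z j1 j2))) N; first exact: small ltN'.
have [cZ1 Y1 X1 P1] := ZP _ _ i12; have [cZ2 Y2 X2 P2] := ZP _ _ j12.
exists (Z i1 i2), (Z j1 j2); split=> //.
have segs s (h : 'I_6 -> G) z : before (fun i => index (h i) s) T1 T2 ->
    z \in segment s (h i1) (h i2) -> z \notin segment s (h j1) (h j2).
  by move=> hT; apply: segment_disjoint; exact: hT.
have segs' s (h : 'I_6 -> G) z : before (fun i => index (h i) s) T2 T1 ->
    z \in segment s (h i1) (h i2) -> z \notin segment s (h j1) (h j2).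
  by move=> hT z1; apply: contraL z1; apply: segment_disjoint; exact: hT.
apply/disjointP=> z z1; apply/negP=> z2.
have [zY|zY] := boolP (z \in Y).
  by have /negP := segs Y a z fT (Y1 z z1 zY); apply; exact: Y2.
have [zX|zX] := boolP (z \in X).
  case: gT => [/segs|/segs'] h; first by have /negP := h z (X1 z z1 zX); apply; exact: X2.
  by have /negP := h z (X1 z z1 zX); apply; exact: X2.
have neq i j : i \in T1 -> j \in T2 -> i != j.
  by move=> iT jT; apply: contraTneq (fT i j iT jT) => ->; rewrite ltnn.
have dPn i j : i \in T1 -> j \in T2 -> z \in P i -> z \notin P j.
  by move=> iT jT; apply/disjointP/dP; exact: neq.
have := P1 z z1 zX zY; rewrite in_setU; have := P2 z z2 zX zY; rewrite in_setU.
by case/orP=> zj; case/orP=> zi; move: zj; apply/negP; apply: dPn zi.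
Qed.

End DisjointCycles.


(** * The grid *)

(** The boundary of the grid is numbered from 0 to 11 along the outer cycle,
    starting next to a corner so that the corners are 1, 4, 7 and 10.  The inner
    cycle is numbered from 12 to 15, in such a way that the vertex [12 + j] is
    adjacent to the vertices [3 * j] and [3 * j + 2] of the outer cycle. *)
Definition grid_code (x : grid 4 4) : nat :=
  nth 0 (nth [::] [:: [:: 1; 2; 3; 4]; [:: 0; 12; 13; 5]; [:: 11; 15; 14; 6]; [:: 10; 9; 8; 7]] x.1) x.2.

(** Steps along the outer cycle and along the inner cycle, each followed by the
    step that closes the cycle, and the edges between the two cycles. *)
Definition code_edge m n :=
  [|| (m.+1 == n) && (n < 12), (m == 11) && (n == 0),
      [&& 12 <= m, m.+1 == n & n < 16], (m == 15) && (n == 12)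
    | [&& m < 12, m %% 3 != 1 & n == 12 + m %/ 3]].

Lemma grid_codeP (x y : grid 4 4) :
  [&& grid_code x < 16, (grid_code x == grid_code y) == (x == y)
    & edge x y ==> code_edge (grid_code x) (grid_code y) || code_edge (grid_code y) (grid_code x)].
Proof.
case: x => -[[|[|[|[|//]]]] hx1] -[[|[|[|[|//]]]] hx2];
by case: y => -[[|[|[|[|//]]]] hy1] -[[|[|[|[|//]]]] hy2].
Qed.

Section GridModel.
Variable G : sgraph.
Variables (c D0 D1 D2 D3 : seq G) (a : nat -> G) (p : nat -> seq G).

Let d := D0 ++ D1 ++ D2 ++ D3.
Let D j := nth [::] [:: D0; D1; D2; D3] j.

Hypothesis cycle_c : ucycle (@edge G) c.
Hypothesis cycle_d : ucycle (@edge G) d.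
Hypothesis disj_cd : {in c, forall z, z \notin d}.
Hypothesis a_c : forall k, k < 12 -> a k \in c.
Hypothesis a_mono : forall k, k.+1 < 12 -> index (a k) c < index (a k.+1) c.
Hypothesis p_path : forall k, k < 12 -> path (@edge G) (a k) (p k).
Hypothesis p_last : forall k, k < 12 -> last (a k) (p k) \in D (k %/ 3).
Hypothesis p_c : forall k, k < 12 -> {in p k, forall z, z \notin c}.
Hypothesis p_d : forall k, k < 12 -> {in belast (a k) (p k), forall z, z \notin d}.
Hypothesis p_disj : forall k l z, k < 12 -> l < 12 ->
  z \in a k :: p k -> z \in a l :: p l -> k = l.

(** The cycle [c] is cut into twelve arcs, each containing the start of one path.
    The inner part of the path is added to its arc, and its last vertex lies on
    the other cycle, each part [D j] of which is contracted. *)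
Definition cut k := if k == 0 then 0 else if k < 12 then index (a k) c else size c.
Definition arc k := [set z in c | cut k <= index z c < cut k.+1].
Definition outer k := arc k :|: [set z in belast (a k) (p k)].
Definition branch n := if n < 12 then outer n else [set z in D (n - 12)].

Lemma cut_mono k l : k < l -> l <= 12 -> cut k < cut l.
Proof.
have step k' : k' < 12 -> cut k' < cut k'.+1.
  rewrite /cut /=; case: k' => [|k'] /= h.
    exact: leq_ltn_trans (leq0n _) (@a_mono 0 isT).
  by rewrite h; case: (ltnP k'.+2 12) => h'; [exact: a_mono|rewrite index_mem a_c].
elim: l => // l IH; rewrite ltnS leq_eqVlt => /predU1P[->|kl] hl; first exact: step.
exact: ltn_trans (IH kl (ltnW hl)) (step l hl).
Qed.

Lemma cut_a k : k < 12 -> cut k <= index (a k) c < cut k.+1.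
Proof.
move=> h; rewrite /cut /= h; case: k h => [|k] h /=; first by rewrite a_mono.
by rewrite leqnn; case: (ltnP k.+2 12) => h'; [exact: a_mono|rewrite index_mem a_c].
Qed.

Lemma a_arc k : k < 12 -> a k \in arc k.
Proof. by move=> h; rewrite in_set a_c // cut_a. Qed.

Lemma arc_disj k l z : k < 12 -> l < 12 -> z \in arc k -> z \in arc l -> k = l.
Proof.
move=> hk hl; rewrite !in_set => /and3P[_ k1 k2] /and3P[_ l1 l2].
have mono i j : i < j -> j < 12 -> cut i.+1 <= cut j.
  by move=> ij hj; case: (ltngtP i.+1 j) ij => // [h _|<- //]; rewrite ltnW // cut_mono // ltnW.
case: (ltngtP k l) => // [kl|lk].
  by have := leq_trans k2 (leq_trans (mono _ _ kl hl) l1); rewrite ltnn.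
by have := leq_trans l2 (leq_trans (mono _ _ lk hk) k1); rewrite ltnn.
Qed.

Lemma outer_sub k z : k < 12 -> z \in outer k ->
  (z \in c /\ z \in arc k) \/ (z \in a k :: p k /\ z \notin c).
Proof.
move=> hk; rewrite in_setU => /orP[zk|].
  by left; split=> //; move: zk; rewrite in_set => /andP[].
rewrite in_set => /mem_belast; rewrite inE => /predU1P[->|zp].
  by left; split; [exact: a_c|exact: a_arc].
by right; split; [rewrite zp orbT|exact: p_c zp].
Qed.

Lemma outer_disj k l z : k < 12 -> l < 12 -> z \in outer k -> z \in outer l -> k = l.
Proof.
move=> hk hl /(outer_sub hk)[] [h1 h2] /(outer_sub hl)[] [h3 h4].
- exact: arc_disj h2 h4.
- by rewrite h1 in h4.
- by rewrite h3 in h2.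
- exact: p_disj h1 h3.
Qed.

Lemma outer_d k z : k < 12 -> z \in outer k -> z \notin d.
Proof.
move=> hk; rewrite in_setU !in_set => /orP[/andP[zc _]|]; first exact: disj_cd.
exact: p_d.
Qed.

Lemma D_sub j z : z \in D j -> z \in d.
Proof.
rewrite /D /d !mem_cat; case: j => [|[|[|[|j]]]] /= h; rewrite ?h ?orbT //.
by rewrite nth_nil in h.
Qed.

Lemma D_disj i j z : z \in D i -> z \in D j -> i = j.
Proof.
have cat2 (s t : seq G) : uniq (s ++ t) -> (forall w, w \in s -> w \in t -> false) /\ uniq t.
  rewrite cat_uniq => /and3P[_ /hasPn h ->]; split=> // w ws /h.
  by rewrite /= ws.
have [h0 u0] := cat2 _ _ (andP cycle_d).2; have [h1 u1] := cat2 _ _ u0; have [h2 _] := cat2 _ _ u1.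
have lt i' j' w : i' < j' -> w \in D i' -> w \in D j' -> false.
  rewrite /D; case: i' => [|[|[|i']]]; case: j' => [|[|[|[|j']]]] //= _ wi wj.
  all: try by rewrite nth_nil in wj.
  all: try by (apply: h0 wi _; rewrite !mem_cat wj ?orbT).
  all: try by (apply: h1 wi _; rewrite !mem_cat wj ?orbT).
  exact: h2 wi wj.
move=> zi zj; case: (ltngtP i j) => // h; first by have := lt _ _ z h zi zj.
by have := lt _ _ z h zj zi.
Qed.

Lemma branch_disj m n z : m < 16 -> n < 16 -> z \in branch m -> z \in branch n -> m = n.
Proof.
rewrite /branch => hm hn; case: (ltnP m 12) => m12; case: (ltnP n 12) => n12.
- exact: outer_disj.
- by move=> /(outer_d m12) /negP h; rewrite in_set => /D_sub.
- by rewrite in_set => /D_sub zd /(outer_d n12); rewrite zd.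
by rewrite !in_set => zm zn; have := D_disj zm zn; lia.
Qed.

Lemma D_nonempty j : j < 4 -> exists x q, D j = x :: q.
Proof.
move=> hj; have h : j * 3 < 12 by lia.
by have := p_last h; rewrite mulnK //; case: (D j) => // x q _; exists x, q.
Qed.

Lemma sorted_connected x q : sorted (@edge G) (x :: q) -> connected_set [set z in x :: q].
Proof. exact: walk_connected. Qed.

Lemma cycle_sorted e' (s : seq G) : cycle e' s -> sorted e' s.
Proof. by case: s => //= x q; rewrite rcons_path => /andP[]. Qed.

Lemma D_connected j : j < 4 -> connected_set [set z in D j].
Proof.
move=> hj; have [x [q Dj]] := D_nonempty hj; rewrite Dj; apply: sorted_connected; rewrite -Dj.
have /andP[/cycle_sorted/cat_sorted2[s0 /cat_sorted2[s1 /cat_sorted2[s2 s3]]] _] := cycle_d.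
by case: j hj {Dj} => [|[|[|[|j]]]].
Qed.

Lemma D_edge j : j < 4 -> exists u v, [/\ u \in D j, v \in D (j.+1 %% 4) & edge u v].
Proof.
have [x0 [q0 E0]] : exists x q, D0 = x :: q := @D_nonempty 0 isT.
have [x1 [q1 E1]] : exists x q, D1 = x :: q := @D_nonempty 1 isT.
have [x2 [q2 E2]] : exists x q, D2 = x :: q := @D_nonempty 2 isT.
have [x3 [q3 E3]] : exists x q, D3 = x :: q := @D_nonempty 3 isT.
have /andP[+ _] := cycle_d; rewrite /d E0 E1 E2 E3 /= !rcons_cat /= !cat_path /=.
rewrite !rcons_cat /= !cat_path /= !rcons_cat /= !cat_path /= rcons_path.
case/and3P=> _ e01 /and3P[_ e12 /and3P[_ e23 /andP[_ e30]]].
have m x q : last x q \in x :: q := mem_last x q.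
case: j => [|[|[|[|//]]]] _; rewrite /D /= ?E0 ?E1 ?E2 ?E3.
- by exists (last x0 q0), x1; split; rewrite ?m ?mem_head.
- by exists (last x1 q1), x2; split; rewrite ?m ?mem_head.
- by exists (last x2 q2), x3; split; rewrite ?m ?mem_head.
- by exists (last x3 q3), x0; split; rewrite ?m ?mem_head.
Qed.

Lemma sorted_c : sorted (@edge G) c.
Proof. by have /andP[/cycle_sorted] := cycle_c. Qed.

Lemma uniq_c : uniq c.
Proof. by have /andP[] := cycle_c. Qed.

Lemma cut_size k : k <= 12 -> cut k <= size c.
Proof.
rewrite leq_eqVlt => /predU1P[-> //|h].
by have := cut_mono (l := 12) h isT; rewrite {2}/cut /= => /ltnW.
Qed.

Lemma nth_arc k i : k < 12 -> cut k <= i < cut k.+1 -> nth (a 0) c i \in arc k.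
Proof.
move=> hk /andP[ki ik]; have ic : i < size c by exact: leq_trans ik (cut_size hk).
by rewrite in_set mem_nth //= index_uniq ?uniq_c // ki.
Qed.

Lemma outer_connected k : k < 12 -> connected_set (outer k).
Proof.
move=> hk; have ak := a_arc hk.
have lt := cut_mono (ltnSn k) hk; have le := cut_size hk.
pose i := cut k; pose j := (cut k.+1).-1.
have hi : cut k <= i < cut k.+1 by rewrite leqnn.
have hj : cut k <= j < cut k.+1 by rewrite /j; lia.
apply: connectedU.
- have -> : arc k = segment c (nth (a 0) c i) (nth (a 0) c j).
    have ic : i < size c by rewrite /i; lia.
    have jc : j < size c by rewrite /j; lia.
    apply/setP=> z; rewrite !in_set !index_uniq ?uniq_c //.
    rewrite (minn_idPl _) ?(maxn_idPr _) ?/i ?/j; [|lia|lia].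
    by rewrite -[_ <= (cut k.+1).-1]ltnS prednK //; lia.
  have mem n : cut k <= n < cut k.+1 -> nth (a 0) c n \in c.
    by move=> /(nth_arc hk); rewrite in_set => /andP[].
  have [q [eq _ _ ->]] := segment_path sorted_c uniq_c (mem _ hi) (mem _ hj).
  exact: walk_connected.
- have: belast (a k) (p k) = a k :: behead (belast (a k) (p k)).
    have := p_last hk; case: (p k) => //= /D_sub; by rewrite (negPf (disj_cd (a_c hk))).
  move=> E; have ep := p_path hk; case/lastP: (p k) E ep => [//|q z] _.
  rewrite belast_rcons rcons_path => /andP[eq _]; exact: walk_connected.
apply/touchP; exists (a k), (a k); split=> //; last by left.
rewrite in_set; have := p_last hk; case: (p k) => [|y q] /=; last by rewrite mem_head.
by move/D_sub; rewrite (negPf (disj_cd (a_c hk))).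
Qed.

Lemma outer_edge k : k.+1 < 12 -> exists u v, [/\ u \in outer k, v \in outer k.+1 & edge u v].
Proof.
move=> hk; have hk' := ltnW hk.
have lt1 := cut_mono (ltnSn k) hk'; have lt2 := cut_mono (ltnSn k.+1) hk.
have le := cut_size hk; pose i := (cut k.+1).-1.
have iE : i.+1 = cut k.+1 by rewrite /i prednK //; lia.
exists (nth (a 0) c i), (nth (a 0) c i.+1); split.
- by rewrite in_setU nth_arc // /i; lia.
- by rewrite in_setU nth_arc // iE leqnn.
by apply/(sortedP (a 0) sorted_c); rewrite iE; exact: leq_trans lt2 le.
Qed.

Lemma outer_close : exists u v, [/\ u \in outer 11, v \in outer 0 & edge u v].
Proof.
have lt1 := cut_mono (ltnSn 11) isT; have lt2 := cut_mono (ltnSn 0) isT.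
have c12 : cut 12 = size c by [].
exists (nth (a 0) c (size c).-1), (nth (a 0) c 0); split.
- by rewrite in_setU nth_arc // c12; lia.
- by rewrite in_setU nth_arc.
have c_gt0 : 0 < size c by rewrite -c12; exact: leq_ltn_trans lt1.
have /andP[+ _] := cycle_c; rewrite nth_last; case: (c) c_gt0 => //= x q _.
by rewrite rcons_path => /andP[].
Qed.

Lemma rung_edge k : k < 12 -> exists u v, [/\ u \in outer k, v \in D (k %/ 3) & edge u v].
Proof.
move=> hk; have := p_last hk; have := p_path hk.
have: {subset [set z in belast (a k) (p k)] <= outer k}.
  by move=> z zb; rewrite in_setU zb orbT.
case/lastP: (p k) => [_ _ /= /D_sub|q z]; first by rewrite (negPf (disj_cd (a_c hk))).
rewrite belast_rcons rcons_path last_rcons => sub /andP[_ e] zD.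
by exists (last (a k) q), z; split=> //; apply: sub; rewrite in_set mem_last.
Qed.

Lemma branch_edge m n : code_edge m n -> exists u v, [/\ u \in branch m, v \in branch n & edge u v].
Proof.
rewrite /branch => /or4P[/andP[/eqP <- h]|/andP[/eqP-> /eqP->]|/and3P[h1 /eqP h2 h3]|].
- by rewrite h (ltnW h); exact: outer_edge.
- exact: outer_close.
- have [|u [v [uD vD uv]]] := @D_edge (m - 12); first by lia.
  rewrite !ifF; [|lia|lia]; exists u, v; rewrite !in_set; split=> //.
  by move: vD; rewrite modn_small; [have -> : (m - 12).+1 = n - 12 by lia|lia].
case/orP=> [/andP[/eqP-> /eqP->] /=|/and3P[h1 h2 /eqP h3]].
  by have [u [v [uD vD uv]]] := @D_edge 3 isT; exists u, v; rewrite !in_set.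
have [u [v [uO vD uv]]] := rung_edge h1.
by rewrite h1 h3 ltnNge leq_addr /= addKn; exists u, v; rewrite in_set.
Qed.

Lemma grid_model : is_minor (grid 4 4) G.
Proof.
exists (fun x : grid 4 4 => branch (grid_code x)).
have lt16 x : grid_code x < 16 by have /and3P[] := grid_codeP x x.
split=> [x|x y xy|x y xy].
- rewrite /branch; case: ltnP => h; first exact: outer_connected.
  by apply: D_connected; have := lt16 x; lia.
- apply/disjointP=> z zx; apply: contra xy => zy.
  have /and3P[_ /eqP <- _] := grid_codeP x y.
  by rewrite (branch_disj (lt16 x) (lt16 y) zx zy).
have /and3P[_ _ /implyP/(_ xy)/orP[/branch_edge //|/branch_edge]] := grid_codeP x y.
by case=> u [v [ux vy uv]]; exists v, u; rewrite edge_sym.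
Qed.

End GridModel.


(** * From linked cycles to the grid *)

Lemma index_rot (T : eqType) (s : seq T) n x : uniq s -> n <= size s -> x \in s ->
  index x (rot n s) = if index x s < n then size s - n + index x s else index x s - n.
Proof.
move=> us ns xs; rewrite -in_take // /rot index_cat size_drop.
have ix : index x s = if x \in take n s then index x (take n s) else n + index x (drop n s).
  by rewrite -{1}(cat_take_drop n s) index_cat size_takel.
have := us; rewrite -{1}(cat_take_drop n s) cat_uniq => /and3P[_ /hasPn h _].
have := xs; rewrite -{1}(cat_take_drop n s) mem_cat.
move: ix; have [xt|xt] := boolP (x \in take n s) => /= ix xd.
  by have [/h|_] := boolP (x \in drop n s); [rewrite /= xt|rewrite ix].
by rewrite xd ix addKn.
Qed.

Lemma cut_before (T : eqType) (I : finType) (b : I -> T) (c : seq T) (S S' : {set I}) :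
    (forall i, b i \in c) -> before (fun i => index (b i) c) S S' ->
  exists t, (forall i, i \in S -> index (b i) c < t) /\ (forall i, i \in S' -> t <= index (b i) c).
Proof.
move=> bc h; exists (\max_(i in S) (index (b i) c).+1); split=> i iS.
  exact: (leq_bigmax_cond (F := fun i => (index (b i) c).+1)).
by apply/bigmax_leqP=> j jS; exact: h.
Qed.

(** The middle sets have to be nonempty in order that the thresholds between
    consecutive sets increase. *)
Lemma four_cuts (T : eqType) (I : finType) (b : I -> T) (c : seq T) (S1 S2 S3 S4 : {set I}) :
    let g i := index (b i) c in (forall i, b i \in c) ->
    S2 != set0 -> S3 != set0 ->
    before g S1 S2 -> before g S2 S3 -> before g S3 S4 ->
  exists E1 E2 E3 E4, c = E1 ++ E2 ++ E3 ++ E4 /\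
    [/\ forall i, i \in S1 -> b i \in E1, forall i, i \in S2 -> b i \in E2,
        forall i, i \in S3 -> b i \in E3 & forall i, i \in S4 -> b i \in E4].
Proof.
move=> g bc /set0Pn[i2 i2S] /set0Pn[i3 i3S] h12 h23 h34.
have [t1 [l1 u1]] := cut_before bc h12; have [t2 [l2 u2]] := cut_before bc h23.
have [t3 [l3 u3]] := cut_before bc h34.
have t12 : t1 <= t2 by apply: leq_trans (u1 _ i2S) (ltnW (l2 _ i2S)).
have t23 : t2 <= t3 by apply: leq_trans (u2 _ i3S) (ltnW (l3 _ i3S)).
have split3 s t : s <= t -> take t c = take s c ++ drop s (take t c).
  by move=> st; rewrite -{1}(cat_take_drop s (take t c)) take_takel.
have inE3 s t i : s <= g i -> g i < t -> b i \in drop s (take t c).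
  move=> si it; have : b i \in take t c by rewrite in_take.
  rewrite -{1}(cat_take_drop s (take t c)) mem_cat => /orP[|//].
  rewrite take_takel; last exact: ltnW (leq_ltn_trans si it).
  by rewrite in_take // ltnNge -/(g i) si.
exists (take t1 c), (drop t1 (take t2 c)), (drop t2 (take t3 c)), (drop t3 c); split.
  by rewrite catA -split3 // catA -split3 // cat_take_drop.
split=> i iS.
- by rewrite in_take // l1.
- by apply: inE3; [exact: u1|exact: l2].
- by apply: inE3; [exact: u2|exact: l3].
have := bc i; rewrite -{1}(cat_take_drop t3 c) mem_cat => /orP[|//].
by rewrite in_take // ltnNge u3.
Qed.

Lemma three_increasing (I : finType) (f : I -> nat) (S : {set I}) : injective f -> 3 <= #|S| ->
  exists i j k, [/\ i \in S, j \in S, k \in S & f i < f j < f k].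
Proof.
move=> fI cS; have [|s cL] := below_exact (n := 1) fI (S := S); first exact: leq_trans cS.
have cH : 2 <= #|above f S s| by have := below_above f S s; rewrite cL; lia.
have [|t cM] := below_exact (n := 1) fI (S := above f S s); first exact: leq_trans cH.
have cT : 1 <= #|above f (above f S s) t|.
  by have := below_above f (above f S s) t; rewrite cM; lia.
have /card_gt0P[i iL] : 0 < #|below f S s| by rewrite cL.
have /card_gt0P[j jM] : 0 < #|below f (above f S s) t| by rewrite cM.
have /card_gt0P[k kT] := cT.
have sA := subsetP (above_sub f S s).
exists i, j, k; split.
- exact: subsetP (below_sub f S s) _ iL.
- exact: sA _ (subsetP (below_sub _ _ _) _ jM).
- exact: sA _ (subsetP (above_sub _ _ _) _ kT).
rewrite (before_threshold iL (subsetP (below_sub _ _ _) _ jM)).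
exact: before_threshold jM kT.
Qed.

Section Grid.
Variable G : sgraph.
Implicit Types (c d : seq G).

Lemma ucycle_rev c : ucycle (@edge G) c -> ucycle (@edge G) (rev c).
Proof.
case/andP=> cc uc; rewrite /ucycle rev_uniq uc andbT rev_cycle.
by rewrite (eq_cycle (e' := @edge G)) // => x y; exact: edge_sym.
Qed.

Lemma ucycle_swap c d : ucycle (@edge G) (c ++ d) -> ucycle (@edge G) (d ++ c).
Proof. by rewrite -rot_size_cat rot_ucycle. Qed.

Definition rungs (I : finType) c d (a : I -> G) (p : I -> seq G) :=
  [/\ forall i, a i \in c /\ last (a i) (p i) \in d,
      forall i, path (@edge G) (a i) (p i),
      forall i, {in p i, forall z, z \notin c},
      forall i, {in belast (a i) (p i), forall z, z \notin d}
    & forall i j z, z \in a i :: p i -> z \in a j :: p j -> i = j].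

Lemma rungs_eq (I : finType) c d c' d' (a : I -> G) p :
  c =i c' -> d =i d' -> rungs c d a p -> rungs c' d' a p.
Proof.
move=> cc dd [ac ep pc pd disj]; split=> // [i|i z /pc|i z /pd].
- by rewrite -cc -dd.
- by rewrite cc.
- by rewrite dd.
Qed.

Lemma grid_of_blocks (I : finType) c D0 D1 D2 D3 (a : I -> G) p (S0 S1 S2 S3 : {set I}) :
    let f i := index (a i) c in
    ucycle (@edge G) c -> ucycle (@edge G) (D0 ++ D1 ++ D2 ++ D3) ->
    {in c, forall z, z \notin D0 ++ D1 ++ D2 ++ D3} ->
    rungs c (D0 ++ D1 ++ D2 ++ D3) a p ->
    [/\ 3 <= #|S0|, 3 <= #|S1|, 3 <= #|S2| & 3 <= #|S3|] ->
    [/\ before f S0 S1, before f S1 S2 & before f S2 S3] ->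
    [/\ forall i, i \in S0 -> last (a i) (p i) \in D0, forall i, i \in S1 -> last (a i) (p i) \in D1,
        forall i, i \in S2 -> last (a i) (p i) \in D2 & forall i, i \in S3 -> last (a i) (p i) \in D3] ->
  is_minor (grid 4 4) G.
Proof.
move=> f uc ud dcd [acd ep pc pd disj] [c0 c1 c2 c3] [b01 b12 b23] [h0 h1 h2 h3].
have aI : injective a by move=> i j aij; apply: (disj i j (a i)); rewrite ?mem_head // aij mem_head.
have fI : injective f.
  move=> i j fij; apply: aI; have [ai _] := acd i; have [aj _] := acd j.
  by rewrite -(nth_index (a i) ai) -/(f i) fij nth_index.
have [i0 [j0 [k0 [i0S j0S k0S /andP[lt01 lt02]]]]] := three_increasing fI c0.
have [i1 [j1 [k1 [i1S j1S k1S /andP[lt11 lt12]]]]] := three_increasing fI c1.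
have [i2 [j2 [k2 [i2S j2S k2S /andP[lt21 lt22]]]]] := three_increasing fI c2.
have [i3 [j3 [k3 [i3S j3S k3S /andP[lt31 lt32]]]]] := three_increasing fI c3.
pose l := [:: i0; j0; k0; i1; j1; k1; i2; j2; k2; i3; j3; k3].
pose r k := nth i0 l k.
have inc k : k.+1 < 12 -> f (r k) < f (r k.+1).
  have := b01 _ _ k0S i1S; have := b12 _ _ k1S i2S; have := b23 _ _ k2S i3S.
  by move: k; do 11 (case=> [|]; first by []).
have mono k m : k < m -> m < 12 -> f (r k) < f (r m).
  elim: m => // m IH; rewrite ltnS leq_eqVlt => /predU1P[->|km] hm; first exact: inc.
  exact: ltn_trans (IH km (ltnW hm)) (inc m hm).
apply: (@grid_model G c D0 D1 D2 D3 (a \o r) (p \o r)) => //=.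
- by move=> k _; case: (acd (r k)).
- by do 12 (case=> [|]; first by move=> _; first [exact: h0|exact: h1|exact: h2|exact: h3]).
move=> k m z hk hm zk zm; have rE := disj _ _ _ zk zm.
case: (ltngtP k m) => // h; first by have := mono _ _ h hm; rewrite rE ltnn.
by have := mono _ _ h hk; rewrite rE ltnn.
Qed.

(** In the two cases where the blocks come in reversed cyclic order on [d], reverse
    [d] and cut it open at another place. *)
Lemma grid_of_points (I : finType) c d (a : I -> G) p (P Q : {set I}) :
    let f i := index (a i) c in let g i := index (last (a i) (p i)) d in
    ucycle (@edge G) c -> ucycle (@edge G) d -> {in c, forall z, z \notin d} ->
    rungs c d a p -> 10 <= #|P| -> 17 <= #|Q| -> before f P Q -> before g P Q ->
  is_minor (grid 4 4) G.
Proof.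
move=> f g uc ud dcd rg cP cQ fPQ gPQ.
have [acd _ _ _ disj] := rg; pose b i := last (a i) (p i).
have bd i : b i \in d by case: (acd i).
have fI : injective f.
  move=> i j fij; apply: (disj i j (a i)); rewrite ?mem_head //.
  have [ai _] := acd i; have [aj _] := acd j.
  by rewrite -(nth_index (a i) ai) -/(f i) fij nth_index // mem_head.
have gI : injective g.
  move=> i j gij; apply: (disj i j (b i)); first exact: mem_last.
  have -> : b i = b j by rewrite -(nth_index (a i) (bd i)) -[index _ _]/(g i) gij; exact: nth_index (bd j).
  exact: mem_last.
have [S1 [S2 [S3 [S4 [cards [fS gS]]]]]] := four_blocks fI gI cP cQ fPQ gPQ.
have [n1 n2 n3 n4] : [/\ S1 != set0, S2 != set0, S3 != set0 & S4 != set0].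
  by case: cards => k1 k2 k3 k4; split; rewrite -card_gt0; apply: ltn_trans _ (_ : 2 < _).
have finish D1 D2 D3 D4 : ucycle (@edge G) (D1 ++ D2 ++ D3 ++ D4) -> d =i D1 ++ D2 ++ D3 ++ D4 ->
    [/\ forall i, i \in S1 -> b i \in D1, forall i, i \in S2 -> b i \in D2,
        forall i, i \in S3 -> b i \in D3 & forall i, i \in S4 -> b i \in D4] ->
    is_minor (grid 4 4) G.
  move=> uD dD hD; apply: (grid_of_blocks uc uD _ (rungs_eq _ dD rg) cards fS hD) => //.
  by move=> z zc; rewrite -dD; exact: dcd.
case: gS => [] [g1 g2 g3].
- have [E1 [E2 [E3 [E4 [dE hE]]]]] := four_cuts bd n2 n3 g1 g2 g3.
  by apply: (finish E1 E2 E3 E4); rewrite -?dE.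
- have [E1 [E4 [E3 [E2 [dE [h1 h4 h3 h2]]]]]] := four_cuts bd n4 n3 g1 g2 g3.
  apply: (finish (rev E1) (rev E2) (rev E3) (rev E4)).
  + apply: ucycle_swap; rewrite -!catA -!rev_cat -?catA -dE; exact: ucycle_rev.
  + by move=> z; rewrite dE !mem_cat !mem_rev; do !case: (z \in _).
  by split=> i; rewrite mem_rev; [exact: h1|exact: h2|exact: h3|exact: h4].
have [E2 [E1 [E4 [E3 [dE [h2 h1 h4 h3]]]]]] := four_cuts bd n1 n4 g1 g2 g3.
apply: (finish (rev E1) (rev E2) (rev E3) (rev E4)).
- rewrite catA; apply: ucycle_swap; rewrite -!catA -!rev_cat -?catA -dE; exact: ucycle_rev.
- by move=> z; rewrite dE !mem_cat !mem_rev; do !case: (z \in _).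
by split=> i; rewrite mem_rev; [exact: h1|exact: h2|exact: h3|exact: h4].
Qed.

Lemma linked_rungs c d k : linked (@edge G) [set z in c] [set z in d] k ->
  exists a (p : 'I_k -> seq G), rungs c d a p.
Proof.
case/linked_trim=> a [p [[ac pd ep _ disj] trimA trimB]]; exists a, p; split=> // [i|i z|i z].
- by have := ac i; have := pd i; rewrite !in_set.
- by move/trimA; rewrite in_set.
- by move/trimB; rewrite in_set.
Qed.

(** Cut [d] at an arbitrary place, and cut [c] right after the start of the path
    [W] that comes last on [d].  The other 50 paths are split into the first 25
    and the last 25 along [c].  Sweeping along [d] yields a threshold below which
    one half has 10 paths while the other half has 16 paths above it.  Since [W]
    comes last on both cycles, it can be added to the 16.  If the 10 belong to
    the last half, rotate [c] so that this half comes first, followed by [W]. *)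
Theorem grid_of_cycles c d :
    ucycle (@edge G) c -> ucycle (@edge G) d -> {in c, forall z, z \notin d} ->
    linked (@edge G) [set z in c] [set z in d] 51 ->
  is_minor (grid 4 4) G.
Proof.
move=> uc ud dcd /linked_rungs[a [p rg]].
pose g i := index (last (a i) (p i)) d.
have [W _ maxW] := @arg_maxnP _ (ord0 : 'I_51) xpredT g isT.
have [x [s1 [s2 [def_c xW]]]] : exists x s1 s2, c = s1 ++ x :: s2 /\ a W = x.
  have [acd _ _ _ _] := rg; have [aW _] := acd W.
  by case/splitPr: aW => s1 s2; exists (a W), s1, s2.
pose c' := s2 ++ rcons s1 x.
have cc' : c =i c' by move=> z; rewrite def_c /c' !mem_cat mem_rcons !inE orbA orbC; case: (z \in s2); rewrite ?orbT //= orbC.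
have uc' : ucycle (@edge G) c' by apply: ucycle_swap; rewrite cat_rcons -def_c.
have {def_c uc}dcd' : {in c', forall z, z \notin d} by move=> z; rewrite -cc'; exact: dcd.
have rg' : rungs c' d a p by exact: rungs_eq rg.
have [acd _ _ _ disj] := rg'.
have ac i : a i \in c' by case: (acd i).
have bd i : last (a i) (p i) \in d by case: (acd i).
pose f i := index (a i) c'.
have uniq_c' : uniq c' by have /andP[] := uc'.
have fI : injective f.
  move=> i j fij; apply: (disj i j (a i)); rewrite ?mem_head //.
  by rewrite -(nth_index x (ac i)) -/(f i) fij nth_index // mem_head.
have gI : injective g.
  move=> i j gij; apply: (disj i j (last (a i) (p i))); rewrite ?mem_last //.
  by rewrite -(nth_index x (bd i)) -/(g i) gij nth_index // mem_last.
have fW i : i != W -> f i < f W.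
  move=> iW; have szc : (size (s2 ++ s1)).+1 = size c'.
    by rewrite /c' !size_cat size_rcons addnS.
  have xE : x = nth x c' (size (s2 ++ s1)) by rewrite /c' -cats1 catA nth_cat ltnn subnn.
  have fWE : (f W).+1 = size c' by rewrite /f xW {1}xE index_uniq // -szc.
  by rewrite ltn_neqAle -ltnS fWE index_mem ac andbT; apply: contraNneq iW => /fI ->.
have gW i : i != W -> g i < g W.
  move=> iW; rewrite ltn_neqAle; have /= -> := maxW i isT; rewrite andbT.
  by apply: contraNneq iW => /gI ->.
pose S := [set~ W]; have cS : #|S| = 50 by rewrite cardsC1 card_ord.
have SW : forall i, i \in S -> i != W by move=> j; rewrite !inE.
have [|s cL] := below_exact (n := 25) fI (S := S); first by rewrite cS.
set L := below f S s in cL; set R := above f S s.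
have cR : #|R| = 25 by have := below_above f S s; rewrite cS cL -/R; lia.
have LS := subsetP (below_sub f S s); have RS := subsetP (above_sub f S s).
have [t /orP[/andP[h1 h2]|/andP[h1 h2]]] :=
    sweep (m1 := 16) (m2 := 10) gI (disjoint_below_above f S s) isT isT.
  pose P := below g R t; pose Q := W |: above g L t.
  have PR := subsetP (below_sub g R t); have QL := subsetP (above_sub g L t).
  have cQ : 17 <= #|Q|.
    rewrite cardsU1; have -> : W \notin above g L t; last by rewrite add1n ltnS.
    by apply/negP=> /QL/LS; rewrite !inE eqxx.
  have sc : s <= size c'.
    have /card_gt0P[i iR] : 0 < #|R| by rewrite cR.
    by move: iR; rewrite inE => /andP[_ si]; apply: leq_trans si (index_size _ _).
  have cr : c' =i rot s c' by move=> z; rewrite mem_rot.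
  have ind i : index (a i) (rot s c') = if f i < s then size c' - s + f i else f i - s.
    exact: index_rot.
  apply: (@grid_of_points _ (rot s c') d a p P Q) => //.
  - by rewrite rot_ucycle.
  - by move=> z; rewrite mem_rot; exact: dcd'.
  - exact: rungs_eq rg'.
  - move=> i j iP; have iR := PR _ iP; rewrite !ind.
    have si : s <= f i by move: iR; rewrite inE => /andP[].
    have fi : f i < size c' by rewrite index_mem.
    rewrite [f i < s]ltnNge si /= in_setU1 => /predU1P[->|jL].
      have fiW := fW i (SW _ (RS _ iR)).
      rewrite [f W < s]ltnNge (leq_trans si (ltnW fiW)) /=.
      by rewrite ltn_sub2rE.
    have jL' := QL _ jL; move: jL'; rewrite inE => /andP[_ ->].
    by apply: leq_trans (leq_addr _ _); rewrite ltn_sub2rE.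
  move=> i j iP; rewrite in_setU1 => /predU1P[->|jL].
    exact: gW (SW _ (RS _ (PR _ iP))).
  exact: before_threshold iP jL.
pose P := below g L t; pose Q := W |: above g R t.
have PL := subsetP (below_sub g L t); have QR := subsetP (above_sub g R t).
have cP : 10 <= #|P| by have := below_above g L t; rewrite cL -/P; move: h2; rewrite -/L; lia.
have cQ : 17 <= #|Q|.
  rewrite cardsU1; have -> : W \notin above g R t.
    by apply/negP=> /QR/RS; rewrite !inE eqxx.
  by have := below_above g R t; rewrite cR; move: h1; rewrite -/R; lia.
apply: (@grid_of_points _ c' d a p P Q) => //.
  move=> i j iP; rewrite in_setU1 => /predU1P[->|jR]; first exact: fW (SW _ (LS _ (PL _ iP))).
  exact: before_threshold (PL _ iP) (QR _ jR).
move=> i j iP; rewrite in_setU1 => /predU1P[->|jR].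
  exact: gW (SW _ (LS _ (PL _ iP))).
exact: before_threshold iP jR.
Qed.

End Grid.

Theorem theorem1p8 (G : sgraph) (hG : ~ is_minor (grid 4 4) G) :
  treewidth G <= 160.
Proof.
rewrite leqNgt; apply/negP=> /treewidth_bramble[B [bB ordB]]; apply: hG.
have le162 : 162 <= bramble_order B.
  by have [X cX <-] := order_ex (bramble_nonempty bB); exact: ordB.
have [C1 [C2 [[c uc ->] [d ud ->] dCD ord1 ord2]]] := @disjoint_cycles G B 51 bB isT le162.
apply: (grid_of_cycles uc ud) => [z zc|].
  by have := disjointP dCD z; rewrite !in_set; exact.
apply: linked_sub (bramble_linked bB ord1 ord2) => u v.
by case/and3P.
Qed.
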